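(* There exists a computationally efficient algorithm with the following guarantees. Given as input (i) a DAG $\mathcal{S}$ with $n$ nodes and maximum in-degree $d$ and a known $(c,C)$-balanced Bayes net $Q$ with structure $\mathcal{S}$, where $c=\widetilde\Omega(1/\sqrt n)$ and $C=\widetilde\Omega(d\epsilon^2/\sqrt n)$; (ii) a parameter $\epsilon>0$; and (iii) sample access to an unknown Bayes net $P$ with structure $\mathcal{S}$, the algorithm takes $O(2^{d/2}\sqrt n/\epsilon^2)$ samples from $P$ and distinguishes with probability at least $2/3$ between the cases $P=Q$ and $\|P-Q\|_1>\epsilon$.
   Context: Let $\mathcal{S}$ be a DAG on $[n]$, topologically sorted (all edges go from smaller to larger labels), and let $\Pi(i)$ be the parent set of $i$. A distribution $P$ on $\{0,1\}^n$ is a Bayes net with structure $\mathcal{S}$ if for each $i$, $\Pr_{X\sim P}[X_i=1\mid X_1,\dots,X_{i-1}]$ depends only on $X_{\Pi(i)}$. For $i\in[n]$ and $a\in\{0,1\}^{|\Pi(i)|}$, the parental configuration $\Pi_{i,a}$ is the event $X_{\Pi(i)}=a$, and $p_{i,a}=\Pr_{X\sim P}[X_i=1\mid\Pi_{i,a}]$. $P$ is $(c,C)$-balanced if for all such $(i,a)$: $p_{i,a}\in[c,1-c]$ and $\Pr_P[\Pi_{i,a}]\ge C$. $\|P-Q\|_1=\sum_x|P(x)-Q(x)|$. $\widetilde\Omega$ hides logarithmic factors. *)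

(* Defs.v *)
From mathcomp Require Import all_boot all_order all_algebra.
From mathcomp Require Import reals exp.
Set Implicit Arguments.
Unset Strict Implicit.
Unset Printing Implicit Defensive.
Import Order.TTheory GRing.Theory Num.Theory.
Local Open Scope ring_scope.

Definition cube (n : nat) := {ffun 'I_n -> bool}.

Section Dag.
Variables (n : nat) (S : rel 'I_n).

(* [S j i] is the edge j -> i; a topologically sorted relation is acyclic. *)
Definition topsorted := forall j i : 'I_n, S j i -> (j < i)%N.

Definition parents (i : 'I_n) : {set 'I_n} := [set j | S j i].

Definition max_indegree : nat := \max_(i < n) #|parents i|.

(* The value x_{Pi(i)}, parents being listed in increasing order. *)
Definition parent_values (i : 'I_n) (x : cube n) : bitseq :=
  [seq x j | j <- enum (parents i)].

End Dag.

Section Distributions.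
Variables (R : realType) (n : nat).
Implicit Types (P Q : cube n -> R) (E F : pred (cube n)) (S : rel 'I_n).

Definition is_distribution P :=
  (forall x, 0 <= P x) /\ \sum_x P x = 1.

Definition Pr P E : R := \sum_(x | E x) P x.

(* Equal to 0 when [Pr P F = 0]. *)
Definition condPr P E F : R := Pr P [predI E & F] / Pr P F.

Definition same_prefix (i : 'I_n) (x : cube n) : pred (cube n) :=
  fun y => [forall j : 'I_n, (j < i)%N ==> (y j == x j)].

Definition coord_true (i : 'I_n) : pred (cube n) := fun y => y i.

(* The conditional probability given a prefix is only constrained on prefixes
   of positive probability, where it is defined. *)
Definition bayes_net S P :=
  is_distribution P /\
  forall (i : 'I_n) (x y : cube n),
    0 < Pr P (same_prefix i x) -> 0 < Pr P (same_prefix i y) ->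
    parent_values S i x = parent_values S i y ->
    condPr P (coord_true i) (same_prefix i x) =
    condPr P (coord_true i) (same_prefix i y).

Definition parent_config S (i : 'I_n) (a : bitseq) : pred (cube n) :=
  fun x => parent_values S i x == a.

Definition cond_param S P (i : 'I_n) (a : bitseq) : R :=
  condPr P (coord_true i) (parent_config S i a).

Definition balanced S (c C : R) P :=
  forall (i : 'I_n) (a : #|parents S i|.-tuple bool),
    c <= cond_param S P i a <= 1 - c /\ C <= Pr P (parent_config S i a).

Definition l1_dist P Q : R := \sum_x `|P x - Q x|.

End Distributions.

(* Randomized algorithms: programs of a real RAM with uniform cost. A program
   has finitely many arrays of natural numbers and of real numbers, each array
   being designated by a constant. Natural numbers are only added and
   subtracted, so that t steps produce numbers of O(t) bits more than the
   input; real numbers support field operations and comparisons, but no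
   rounding to a natural number and no constants other than natural numbers. *)
Inductive nexp :=
| NConst of nat
| NLoad of nat & nexp
| NAdd of nexp & nexp
| NSub of nexp & nexp.

Inductive rexp :=
| RNat of nexp
| RLoad of nat & nexp
| RAdd of rexp & rexp
| RSub of rexp & rexp
| RMul of rexp & rexp
| RDiv of rexp & rexp.

Inductive bexp :=
| BLeN of nexp & nexp
| BLeR of rexp & rexp
| BNot of bexp
| BAnd of bexp & bexp.

(* [Draw X e] takes a fresh sample and writes its bits in array X from index e
   on; [Flip X e] writes a fresh fair coin at index e of array X. *)
Inductive cmd :=
| Skip
| NStore of nat & nexp & nexp
| RStore of nat & nexp & rexp
| Draw of nat & nexp
| Flip of nat & nexp
| Seq of cmd & cmd
| If of bexp & cmd & cmd
| While of bexp & cmd.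

Section Semantics.
Variable R : realType.

Record state := State {
  nmem : nat -> nat -> nat;
  rmem : nat -> nat -> R;
  drawn : nat;
  flipped : nat
}.

Fixpoint neval (s : state) (e : nexp) : nat :=
  match e with
  | NConst k => k
  | NLoad X e1 => nmem s X (neval s e1)
  | NAdd e1 e2 => (neval s e1 + neval s e2)%N
  | NSub e1 e2 => (neval s e1 - neval s e2)%N
  end.

Fixpoint reval (s : state) (e : rexp) : R :=
  match e with
  | RNat e1 => (neval s e1)%:R
  | RLoad X e1 => rmem s X (neval s e1)
  | RAdd e1 e2 => reval s e1 + reval s e2
  | RSub e1 e2 => reval s e1 - reval s e2
  | RMul e1 e2 => reval s e1 * reval s e2
  | RDiv e1 e2 => reval s e1 / reval s e2
  end.

Fixpoint beval (s : state) (b : bexp) : bool :=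
  match b with
  | BLeN e1 e2 => (neval s e1 <= neval s e2)%N
  | BLeR e1 e2 => reval s e1 <= reval s e2
  | BNot b1 => ~~ beval s b1
  | BAnd b1 b2 => beval s b1 && beval s b2
  end.

Definition update (T : Type) (M : nat -> nat -> T) (X i : nat) (v : T) :=
  fun Y j : nat => if (Y == X) && (j == i) then v else M Y j.

Definition write_bits (M : nat -> nat -> nat) (X i : nat) (v : bitseq) :=
  fun Y j : nat =>
    if (Y == X) && (i <= j < i + size v)%N then nat_of_bool (nth false v (j - i))
    else M Y j.

(* [smp] and [coin] are the streams of samples and of coin flips. The first
   component of a configuration is the stack of commands left to execute. *)
Definition step (smp : nat -> bitseq) (coin : nat -> bool)
    (cf : seq cmd * state) : seq cmd * state :=
  let: (ks, s) := cf in
  if ks isn't c :: k then cf else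
  match c with
  | Skip => (k, s)
  | NStore X e v =>
      (k, State (update (nmem s) X (neval s e) (neval s v)) (rmem s)
            (drawn s) (flipped s))
  | RStore X e v =>
      (k, State (nmem s) (update (rmem s) X (neval s e) (reval s v))
            (drawn s) (flipped s))
  | Draw X e =>
      (k, State (write_bits (nmem s) X (neval s e) (smp (drawn s))) (rmem s)
            (drawn s).+1 (flipped s))
  | Flip X e =>
      (k, State
            (update (nmem s) X (neval s e) (nat_of_bool (coin (flipped s))))
            (rmem s) (drawn s) (flipped s).+1)
  | Seq c1 c2 => (c1 :: c2 :: k, s)
  | If b c1 c2 => ((if beval s b then c1 else c2) :: k, s)
  | While b c1 => (if beval s b then c1 :: c :: k else k, s)
  end.

Record input := Input { nat_input : seq (seq nat); real_input : seq (seq R) }.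

Definition input_size (inp : input) : nat :=
  (sumn (shape (nat_input inp)) + sumn (shape (real_input inp)))%N.

(* The X-th input sequence is stored in array X; other cells contain 0. *)
Definition init (inp : input) : state :=
  State (fun X j => nth 0%N (nth [::] (nat_input inp) X) j)
        (fun X j => nth 0 (nth [::] (real_input inp) X) j) 0 0.

Definition run (prog : cmd) (inp : input) (smp : nat -> bitseq)
    (coin : nat -> bool) (t : nat) : seq cmd * state :=
  iter t (step smp coin) ([:: prog], init inp).

(* The answer is read in cell 0 of the natural-number array 2. *)
Definition accepts (prog : cmd) (inp : input) (smp : nat -> bitseq)
    (coin : nat -> bool) (t : nat) : bool :=
  nmem (run prog inp smp coin t).2 2 0 != 0%N.

End Semantics.

Section Testing.
Variables (R : realType) (n : nat).

Definition sample_bits (x : cube n) : bitseq := [seq x j | j <- enum 'I_n].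

(* Worst case over all sequences of samples and coin flips. *)
Definition halts_within (prog : cmd) (inp : input R) (m t : nat) :=
  forall (smp : nat -> cube n) (coin : nat -> bool),
    let: (ks, s) := run prog inp (fun j => sample_bits (smp j)) coin t in
    ks = [::] /\ (drawn s <= m)%N.

Definition stream (T : Type) (t0 : T) (m : nat) (w : 'I_m -> T) : nat -> T :=
  fun j => if insub j is Some i then w i else t0.

(* Probability that a program halting within t steps and m draws answers [b],
   over m independent samples from P and t independent fair coins. *)
Definition answer_prob (prog : cmd) (inp : input R) (P : cube n -> R)
    (m t : nat) (b : bool) : R :=
  \sum_(w : {ffun 'I_m -> cube n}) \sum_(r : {ffun 'I_t -> bool})
    (\prod_(j < m) P (w j)) * 2 ^- t *
    (accepts prog inp (stream [::] (fun j => sample_bits (w j)))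
       (stream false r) t == b)%:R.

(* All bit sequences of length k, in lexicographic order. *)
Fixpoint all_bits (k : nat) : seq bitseq :=
  if k is k'.+1 then
    map (cons false) (all_bits k') ++ map (cons true) (all_bits k')
  else [:: [::]].

(* Natural-number arrays: n, and the adjacency matrix of S, row j listing the
   edges out of j. Real arrays: eps, and the tables of the parameters q_{i,a}
   for the successive nodes i. *)
Definition tester_input (S : rel 'I_n) (Q : cube n -> R) (eps : R) : input R :=
  Input
    [:: [:: n];
        flatten [seq [seq nat_of_bool (S j i) | i <- enum 'I_n]
                | j <- enum 'I_n]]
    [:: [:: eps];
        flatten [seq [seq cond_param S Q i a | a <- all_bits #|parents S i|]
                | i <- enum 'I_n]].

Definition sample_scale (S : rel 'I_n) (eps : R) : R :=
  2 `^ ((max_indegree S)%:R / 2) * Num.sqrt n%:R / eps ^+ 2.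

End Testing.

(* The factor A log^k hidden in Omega-tilde. *)
Definition log_factor (R : realType) (A : R) (k n : nat) : R :=
  A * (1 + ln n%:R) ^+ k.

(* Main.v *)
Require Import Defs.
From mathcomp Require Import all_boot all_order all_algebra.
From mathcomp Require Import reals sequences exp.
From mathcomp Require Import ring lra zify.
Set Implicit Arguments.
Unset Strict Implicit.
Unset Printing Implicit Defensive.
Import Order.TTheory GRing.Theory Num.Theory.
Local Open Scope ring_scope.

(* Call g = (i, a) a configuration; a sample hits g when its parents of i take
   the value a. Let D be the number of configurations and q_g the given
   parameters of Q.

   The tester draws m samples, m being about sqrt D / eps^2, and counts the
   hits N_g of each g. It then draws 3 m samples and looks at the bits x_i of
   the first N_g samples which hit g. It rejects if some N_g is below a
   logarithmic threshold or if the second batch hits some g less than N_g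
   times; otherwise it accepts iff the sum over g of

     sum_(k <> l) (y_k - q_g) (y_l - q_g) / (N_g q_g (1 - q_g))

   is at most m eps^2 / 64, where y_1, ..., y_(N_g) are the bits read at g.
   Conditionally on the N_g, the bits read can be taken from independent tapes
   of Bernoulli(p_g) variables: for any nonnegative function, its expectation on
   the event that no g runs out of samples is at most its expectation for
   independent tapes. The statistic thus has mean sum_g (N_g - 1) chi2(p_g, q_g)
   and its variance is computed exactly for independent bits. If P = Q, the
   mean is 0 and the variance at most 4 D. If P is far from Q, then N_g is at
   least m Pr_P[g] / 4 with high probability for all g unless the tester
   rejects, and the mean is at least m eps^2 / 32, since
   |P - Q|_1^2 <= 4 sum_g Pr_P[g] chi2(p_g, q_g). *)

(** * Independent samples *)

Section IidExpectation.
Variables (R : comPzSemiRingType) (T : finType).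
Implicit Types (mu : T -> R) (f g : seq T -> R).

Fixpoint iidE mu (m : nat) f : R :=
  if m is k.+1 then \sum_x mu x * iidE mu k (fun s => f (x :: s)) else f [::].

Lemma eq_iidE mu m f g :
  (forall s, size s = m -> f s = g s) -> iidE mu m f = iidE mu m g.
Proof.
elim: m f g => [|m IH] f g fg /=; first exact: fg.
apply: eq_bigr => x _; congr (_ * _); apply: IH => s sm.
by apply: fg; rewrite /= sm.
Qed.

Lemma iidED mu m f g :
  iidE mu m (fun s => f s + g s) = iidE mu m f + iidE mu m g.
Proof.
elim: m f g => [//|m IH] f g /=; rewrite -big_split /=.
by apply: eq_bigr => x _; rewrite IH mulrDr.
Qed.

Lemma iidEZ mu m a f : iidE mu m (fun s => a * f s) = a * iidE mu m f.
Proof.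
elim: m f => [//|m IH] f /=; rewrite mulr_sumr.
by apply: eq_bigr => x _; rewrite IH mulrCA.
Qed.

Lemma iidE0 mu m : iidE mu m (fun=> 0) = 0.
Proof. by have := iidEZ mu m 0 (fun=> 0); rewrite !mul0r. Qed.

Lemma iidE_sum mu m (I : Type) (r : seq I) (F : I -> seq T -> R) :
  iidE mu m (fun s => \sum_(i <- r) F i s) = \sum_(i <- r) iidE mu m (F i).
Proof.
elim: r => [|i r IH].
  by rewrite big_nil -[RHS](iidE0 mu m); apply: eq_iidE => s _; rewrite big_nil.
by rewrite big_cons -IH -iidED; apply: eq_iidE => s _; rewrite big_cons.
Qed.

Lemma iidE_cst mu m a : \sum_x mu x = 1 -> iidE mu m (fun=> a) = a.
Proof.
by move=> mu1; elim: m => [//|m IH] /=; rewrite IH -mulr_suml mu1 mul1r.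
Qed.

Lemma iidE_cat mu m k f :
  iidE mu (m + k) f = iidE mu m (fun s => iidE mu k (fun t => f (s ++ t))).
Proof. by elim: m f => [|m IH] f //=; apply: eq_bigr => x _; rewrite IH. Qed.

Lemma iidE_prod mu m (h : T -> R) :
  iidE mu m (fun s => \prod_(x <- s) h x) = (\sum_x mu x * h x) ^+ m.
Proof.
elim: m => [|m IH] /=; first by rewrite big_nil.
rewrite exprS -IH mulr_suml; apply: eq_bigr => x _.
rewrite -mulrA; congr (_ * _); rewrite -iidEZ.
by apply: eq_iidE => s _; rewrite big_cons.
Qed.

Lemma iidE_density mu m f :
  iidE mu m f = iidE (fun=> 1) m (fun s => (\prod_(x <- s) mu x) * f s).
Proof.
elim: m f => [|m IH] f /=; first by rewrite big_nil mul1r.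
apply: eq_bigr => x _; rewrite mul1r IH -iidEZ.
by apply: eq_iidE => s _; rewrite big_cons mulrA.
Qed.

Lemma big_ffun_ordS (V : Type) (idx : V) (op : Monoid.com_law idx) m
    (F : {ffun 'I_m.+1 -> T} -> V) :
  \big[op/idx]_w F w =
  \big[op/idx]_x \big[op/idx]_(w : {ffun 'I_m -> T})
    F [ffun j => if unlift ord0 j is Some k then w k else x].
Proof.
rewrite pair_big /= (reindex (fun p : T * {ffun 'I_m -> T} =>
  [ffun j => if unlift ord0 j is Some k then p.2 k else p.1])) //=.
exists (fun w : {ffun 'I_m.+1 -> T} => (w ord0, [ffun k => w (lift ord0 k)])).
  case=> x w _ /=; rewrite ffunE unlift_none; congr (_, _).
  by apply/ffunP => k; rewrite !ffunE liftK.
move=> w _; apply/ffunP => j; rewrite ffunE /=.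
by case: unliftP => [k|] -> //; rewrite ffunE.
Qed.

Lemma iidE_ffun mu m f :
  \sum_(w : {ffun 'I_m -> T}) (\prod_(j < m) mu (w j)) * f (codom w)
  = iidE mu m f.
Proof.
elim: m f => [|m IH] f /=.
  rewrite (eq_bigr (fun=> f [::])) => [|w _].
    by rewrite sumr_const card_ffun card_ord expn0.
  rewrite big_ord0 mul1r; congr f; apply/size0nil.
  by rewrite size_codom card_ord.
rewrite big_ffun_ordS; apply: eq_bigr => x _; rewrite -IH mulr_sumr.
apply: eq_bigr => w _; rewrite big_ord_recl ffunE unlift_none -mulrA.
congr (_ * (_ * f _)).
  by apply: eq_bigr => j _; rewrite ffunE liftK.
rewrite /codom /image_mem enum_ordSl /= ffunE unlift_none; congr (_ :: _).
by rewrite -map_comp; apply: eq_map => j /=; rewrite ffunE liftK.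
Qed.

End IidExpectation.

Arguments eq_iidE {R T mu m f g}.

Lemma iidE_prefix (R : comPzSemiRingType) (T : finType) m (t : seq T)
    (f : seq T -> R) :
  iidE (fun=> 1) m (fun y => (prefix y t)%:R * f y) =
  (m <= size t)%:R * f (take m t).
Proof.
elim: m t f => [|m IH] t f /=; first by rewrite take0 prefix0s.
case: t => [|x t] /=.
  rewrite mul0r big1 // => y _.
  by rewrite (eq_iidE (g := fun=> 0)) ?iidE0 ?mulr0 // => s _; rewrite mul0r.
rewrite (bigD1 x) //= big1 ?addr0 => [|y /negbTE yx].
  by rewrite mul1r ltnS -(IH t (fun s => f (x :: s))) eqxx.
by rewrite yx (eq_iidE (g := fun=> 0)) ?iidE0 ?mulr0 // => s _; rewrite mul0r.
Qed.

Lemma exchange_iidE (R : comPzSemiRingType) (T U : finType) (mu : T -> R)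
    (nu : U -> R) m k (f : seq T -> seq U -> R) :
  iidE mu m (fun s => iidE nu k (f s)) =
  iidE nu k (fun t => iidE mu m (fun s => f s t)).
Proof.
elim: m f => [|m IH] f //=; rewrite iidE_sum.
by apply: eq_bigr => x _; rewrite iidEZ IH.
Qed.

Section IidProbability.
Variables (R : numFieldType) (T : finType) (mu : T -> R).
Implicit Types (f g : seq T -> R) (E F : pred (seq T)).
Hypothesis mu_ge0 : forall x, 0 <= mu x.

Lemma ler_iidE m f g :
  (forall s, size s = m -> f s <= g s) -> iidE mu m f <= iidE mu m g.
Proof.
elim: m f g => [|m IH] f g fg /=; first exact: fg.
apply: ler_sum => x _; apply: ler_wpM2l => //; apply: IH => s sm.
by apply: fg; rewrite /= sm.
Qed.

Definition iidPr m E : R := iidE mu m (fun s => (E s)%:R).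

Lemma iidPr_le m E F :
  (forall s, size s = m -> E s -> F s) -> iidPr m E <= iidPr m F.
Proof.
by move=> EF; apply: ler_iidE => s /EF; rewrite ler_nat; case: (E s) => // ->.
Qed.

Lemma iidPr_eq0 m E : (forall s, size s = m -> ~~ E s) -> iidPr m E = 0.
Proof.
by move=> nE; rewrite -(iidE0 mu m); apply: eq_iidE => s /nE/negbTE ->.
Qed.

Lemma iidPrU m E F : iidPr m (predU E F) <= iidPr m E + iidPr m F.
Proof.
rewrite -iidED; apply: ler_iidE => s _ /=.
by rewrite -natrD ler_nat; case: (E s) => //; rewrite leq_addr.
Qed.

Lemma iidPr_exists (I : finType) m (E : I -> pred (seq T)) :
  iidPr m (fun s => [exists i, E i s]) <= \sum_i iidPr m (E i).
Proof.
rewrite -iidE_sum; apply: ler_iidE => s _; rewrite -natr_sum ler_nat.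
by case: existsP => // -[i Ei]; rewrite (bigD1 i) //= Ei.
Qed.

Lemma iidPr_markov m E f c : 0 < c -> (forall s, 0 <= f s) ->
  (forall s, size s = m -> E s -> c <= f s) -> iidPr m E <= iidE mu m f / c.
Proof.
move=> c0 f0 Ef; rewrite ler_pdivlMr // mulrC -iidEZ.
apply: ler_iidE => s /Ef; case: (E s) => [|_]; last by rewrite mulr0.
by rewrite mulr1; apply.
Qed.

Hypothesis mu_sum1 : \sum_x mu x = 1.

Lemma iidPrC m E : iidPr m (predC E) = 1 - iidPr m E.
Proof.
apply/eqP; rewrite eq_sym subr_eq -iidED; apply/eqP.
rewrite -[LHS](iidE_cst m 1 mu_sum1); apply: eq_iidE => s _ /=.
by case: (E s); rewrite ?add0r ?addr0.
Qed.

Lemma iidPr_cat m k (E : seq T -> pred (seq T)) :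
  iidPr (m + k) (fun s => E (take m s) (drop m s)) =
  iidE mu m (fun s => iidPr k (E s)).
Proof.
rewrite /iidPr iidE_cat; apply: eq_iidE => s sm; apply: eq_iidE => t _.
by rewrite (take_size_cat _ sm) (drop_size_cat _ sm).
Qed.

Lemma iidPr_cat_le m k (E : seq T -> pred (seq T)) c :
  (forall s, size s = m -> iidPr k (E s) <= c) ->
  iidPr (m + k) (fun s => E (take m s) (drop m s)) <= c.
Proof.
by move=> Ec; rewrite iidPr_cat -[leRHS](iidE_cst m c mu_sum1); exact: ler_iidE.
Qed.

Lemma iidPr_take m k E : iidPr (m + k) (fun s => E (take m s)) = iidPr m E.
Proof.
rewrite (iidPr_cat m k (fun s _ => E s)).
by apply: eq_iidE => s _; rewrite /iidPr iidE_cst.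
Qed.

End IidProbability.

Section IndependentSum.
Variables (R : comPzRingType) (I : Type) (T : finType).
Variables (mu : I -> T -> R) (N : I -> nat) (Z : I -> seq T -> R).

(* Expectation of [phi (a + \sum_(i <- r) Z i (y i))], each [y i] consisting
   of [N i] independent samples from [mu i]. *)
Fixpoint indep_sumE (phi : R -> R) (r : seq I) (a : R) : R :=
  if r is i :: r' then
    iidE (mu i) (N i) (fun y => indep_sumE phi r' (a + Z i y))
  else phi a.

Lemma indep_sumE_sqr (mean var : I -> R) r a b :
  (forall i, \sum_x mu i x = 1) ->
  (forall i, iidE (mu i) (N i) (Z i) = mean i) ->
  (forall i, iidE (mu i) (N i) (fun y => Z i y ^+ 2) = mean i ^+ 2 + var i) ->
  indep_sumE (fun t => (t - b) ^+ 2) r a =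
  \sum_(i <- r) var i + (a + \sum_(i <- r) mean i - b) ^+ 2.
Proof.
move=> mu1 EZ EZ2; elim: r a => [|i r IH] a /=.
  by rewrite !big_nil add0r addr0.
rewrite !big_cons; set V := \sum_(j <- r) var j; set M := \sum_(j <- r) mean j.
pose c := a + M - b.
rewrite (eq_iidE (g := fun y =>
  Z i y ^+ 2 + (2 * c * Z i y + (V + c ^+ 2)))) => [|y _].
  by rewrite iidED EZ2 iidED iidEZ EZ iidE_cst // /c; ring.
by rewrite IH -/V -/M /c; ring.
Qed.

End IndependentSum.

(** * Products of prefix kernels *)

Definition flip n (k : 'I_n) (x : cube n) : cube n :=
  [ffun j => if j == k then ~~ x j else x j].

Lemma flipK n (k : 'I_n) : involutive (flip k).
Proof.
by move=> x; apply/ffunP => j; rewrite !ffunE; case: eqP => // _; rewrite negbK.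
Qed.

Lemma flip_lt n (k : 'I_n) x (j : 'I_n) : (j < k)%N -> flip k x j = x j.
Proof. by move=> jk; rewrite ffunE -(inj_eq val_inj) /= ltn_eqF. Qed.

Definition depends_on_prefix (V : Type) n (k : nat) (h : cube n -> V) : Prop :=
  forall x y : cube n, (forall j : 'I_n, (j < k)%N -> x j = y j) -> h x = h y.

Lemma depends_on_prefixW (V : Type) n k m (h : cube n -> V) :
  (k <= m)%N -> depends_on_prefix k h -> depends_on_prefix m h.
Proof. by move=> km hk x y xy; apply: hk => j jk; apply: xy; apply: leq_trans km. Qed.

Lemma prefix_flip (V : Type) n (k : 'I_n) m (h : cube n -> V) x :
  (m <= k)%N -> depends_on_prefix m h -> h (flip k x) = h x.
Proof. by move=> mk hm; apply: hm => j jm; rewrite flip_lt // (leq_trans jm). Qed.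

Section PrefixKernel.
Variables (R : numDomainType) (n : nat) (K : 'I_n -> cube n -> bool -> R).
Hypothesis K_prefix : forall i : 'I_n, depends_on_prefix i (K i).
Hypothesis K_sum1 : forall i x, \sum_b K i x b = 1.

Lemma sum_prefix_kernelS (i0 : 'I_n) (h : cube n -> R) : depends_on_prefix i0 h ->
  2 * (\sum_x h x * \prod_(i < n | (i < i0.+1)%N) K i x (x i)) =
  \sum_x h x * \prod_(i < n | (i < i0)%N) K i x (x i).
Proof.
move=> h_prefix; pose H x := \prod_(i < n | (i < i0)%N) K i x (x i).
have prodS x : \prod_(i < n | (i < i0.+1)%N) K i x (x i) = K i0 x (x i0) * H x.
  rewrite (bigD1 i0) //=; congr (_ * _); apply: eq_bigl => i.
  by rewrite ltnS [in RHS]ltn_neqAle andbC -(inj_eq val_inj).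
under eq_bigr do rewrite prodS.
have H_flip x : H (flip i0 x) = H x.
  apply: eq_bigr => i ii0; rewrite flip_lt //.
  by rewrite (prefix_flip _ (ltnW ii0) (@K_prefix i)).
rewrite mulr_natl mulr2n {2}(reindex_inj (can_inj (flipK i0))) /= -big_split /=.
apply: eq_bigr => x _; rewrite H_flip (prefix_flip _ _ h_prefix) //.
rewrite (prefix_flip _ _ (@K_prefix i0)) // ffunE eqxx -mulrDr -mulrDl.
have := K_sum1 i0 x; rewrite big_bool.
by case: (x i0) => /= K1; rewrite ?[K _ _ false + _]addrC K1 mul1r.
Qed.

Lemma sum_prefix_kernel_lt k (h : cube n -> R) :
  (k <= n)%N -> depends_on_prefix k h ->
  2 ^+ (n - k) * (\sum_x h x * \prod_(i < n) K i x (x i)) =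
  \sum_x h x * \prod_(i < n | (i < k)%N) K i x (x i).
Proof.
move: {2}(n - k)%N (erefl (n - k)%N) => d; elim: d k => [|d IH] k dE kn hk.
  have {dE kn}-> : k = n by apply/eqP; rewrite eqn_leq kn -subn_eq0 dE.
  by rewrite subnn mul1r; under [RHS]eq_bigr do under eq_bigl do rewrite ltn_ord.
have ltkn : (k < n)%N by rewrite -subn_gt0 dE.
rewrite -(sum_prefix_kernelS (i0 := Ordinal ltkn)) // -IH //; last first.
- exact: depends_on_prefixW hk.
- by rewrite subnS dE.
by rewrite mulrA -exprS subnSK.
Qed.

Lemma sum_prefix_kernel : \sum_(x : cube n) \prod_(i < n) K i x (x i) = 1.
Proof.
have pow2_neq0 : 2 ^+ n != 0 :> R by rewrite expf_neq0 ?pnatr_eq0.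
apply: (mulfI pow2_neq0); rewrite mulr1 -[X in 2 ^+ X]subn0.
rewrite (eq_bigr (fun x => 1 * \prod_(i < n) K i x (x i))) => [|x _]; last first.
  by rewrite mul1r.
rewrite (sum_prefix_kernel_lt (k := 0) (h := fun=> 1)) //.
rewrite (eq_bigr (fun=> 1)) => [|x _]; last by rewrite mul1r big_pred0_eq.
by rewrite sumr_const card_ffun card_bool card_ord subn0 -natrX.
Qed.

End PrefixKernel.

(* Forcing bit i0 to [b] gives another prefix kernel, which agrees with [K]
   before i0. *)
Lemma sum_prefix_kernel_bit (R : numDomainType) n (K : 'I_n -> cube n -> bool -> R)
    (i0 : 'I_n) (h : cube n -> R) (b : bool) :
  (forall i : 'I_n, depends_on_prefix i (K i)) ->
  (forall i x, \sum_b K i x b = 1) -> depends_on_prefix i0 h ->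
  \sum_(x : cube n | x i0 == b) h x * \prod_(i < n) K i x (x i) =
  \sum_x h x * K i0 x b * \prod_(i < n) K i x (x i).
Proof.
move=> K_prefix K_sum1 h_prefix.
pose K' (i : 'I_n) x b' : R := if i == i0 then (b' == b)%:R else K i x b'.
have K'_prefix (i : 'I_n) : depends_on_prefix i (K' i).
  by move=> x y xy; rewrite /K' (K_prefix i x y xy).
have K'_sum1 i x : \sum_b' K' i x b' = 1.
  rewrite /K'; case: eqP => // _.
  by rewrite big_bool; case: (b); rewrite /= ?addr0 ?add0r.
have hK_prefix : depends_on_prefix i0 (fun x => h x * K i0 x b).
  by move=> x y xy; rewrite (h_prefix x y xy) (K_prefix i0 x y xy).
have forced (x : cube n) : (if x i0 == b then h x * \prod_(i < n) K i x (x i) else 0) =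
    h x * K i0 x b * \prod_(i < n) K' i x (x i).
  rewrite (bigD1 i0) //= [in RHS](bigD1 i0) //= {1}/K' eqxx.
  rewrite [in RHS](eq_bigr (fun i => K i x (x i))) => [|i /negbTE ii0].
    by case: eqP => [->|_]; rewrite ?mul1r ?mul0r ?mulr0 ?mulrA.
  by rewrite /K' ii0.
rewrite big_mkcond (eq_bigr _ (fun x _ => forced x)).
have pow2_neq0 : 2 ^+ (n - i0) != 0 :> R by rewrite expf_neq0 ?pnatr_eq0.
apply: (mulfI pow2_neq0); rewrite !sum_prefix_kernel_lt ?(ltnW (ltn_ord i0)) //.
apply: eq_bigr => x _; congr (_ * _); apply: eq_bigr => i ii0.
by rewrite /K' -(inj_eq val_inj) ltn_eqF.
Qed.

(** * Configurations and tapes *)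

Definition bern (R : pzRingType) (p : R) (b : bool) : R := if b then p else 1 - p.

Lemma sum_bern (R : pzRingType) (p : R) : \sum_b bern p b = 1.
Proof. by rewrite big_bool /bern /= addrC subrK. Qed.

Lemma bern_ge0 (R : numDomainType) (p : R) b : 0 <= p <= 1 -> 0 <= bern p b.
Proof. by case/andP=> p0 p1; case: b; rewrite /bern ?subr_ge0. Qed.

Definition weight (R : pzRingType) (p : R) (s : bitseq) : R :=
  \prod_(b <- s) bern p b.

Lemma weight_ge0 (R : numDomainType) (p : R) s : 0 <= p <= 1 -> 0 <= weight p s.
Proof. by move=> p01; apply: prodr_ge0 => b _; exact: bern_ge0. Qed.

Definition head_agrees (s : bitseq) (b : bool) : bool :=
  if s is b' :: _ then b' == b else true.

Section ForcedBit.
Variables (R : comPzRingType) (p : R).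

Definition forced_bern (L : bitseq) (b : bool) : R :=
  if L is b' :: _ then (b' == b)%:R else bern p b.

Lemma sum_forced_bern L : \sum_b forced_bern L b = 1.
Proof.
case: L => [|b s] /=; first exact: sum_bern.
by rewrite big_bool; case: b; rewrite /= ?addr0 ?add0r.
Qed.

Lemma weight_forced L b :
  bern p b * ((head_agrees L b)%:R * weight p (behead L)) =
  weight p L * forced_bern L b.
Proof.
case: L => [|b' s] /=; first by rewrite mul1r mulrC.
rewrite /weight big_cons; case: eqP => [->|_]; first by rewrite mul1r mulr1.
by rewrite mul0r !mulr0.
Qed.

End ForcedBit.

(* An element of [G] stands for a configuration (i, a): its node i is
   [node_of g], and [config_of i x] is (i, a) for the value a that [x] gives to
   the parents of i. *)
Record config_system n (G : finType) := ConfigSystem {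
  config_of : 'I_n -> cube n -> G;
  node_of : G -> 'I_n;
  config_ofK : forall i x, node_of (config_of i x) = i;
  config_of_prefix : forall i : 'I_n, depends_on_prefix i (config_of i)
}.

Section Tapes.
Variables (n : nat) (G : finType) (cs : config_system n G).
Implicit Types (g : G) (x : cube n) (ws : seq (cube n)).

Definition hit g x : bool := config_of cs (node_of cs g) x == g.
Definition hit_bit g x : bool := x (node_of cs g).
Definition hits ws g : nat := count (hit g) ws.
Definition tape g ws : bitseq := [seq hit_bit g x | x <- ws & hit g x].

Lemma size_tape g ws : size (tape g ws) = hits ws g.
Proof. by rewrite size_map size_filter. Qed.

Lemma big_hit (V : Type) (idx : V) (op : Monoid.com_law idx)
    (F : G -> bool -> V) x :
  \big[op/idx]_i F (config_of cs i x) (x i) =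
  \big[op/idx]_(g | hit g x) F g (hit_bit g x).
Proof.
rewrite [RHS](reindex_onto ((config_of cs)^~ x) (node_of cs)) => [|g /eqP //].
apply: eq_big => i; first by rewrite /hit config_ofK !eqxx.
by rewrite /hit_bit config_ofK.
Qed.

Definition agrees (s : bitseq) g x : bool :=
  hit g x ==> head_agrees s (hit_bit g x).

Definition unread (s : bitseq) g x : bitseq := if hit g x then behead s else s.

Lemma prefix_tape_cons s g x ws :
  prefix s (tape g (x :: ws)) = agrees s g x && prefix (unread s g x) (tape g ws).
Proof.
rewrite /tape /= /agrees /unread; case: ifP => //= _.
by case: s => [|b s] //=; rewrite prefix0s.
Qed.

Variable R : realType.

Definition hit_prob (P : cube n -> R) g : R := Pr P (hit g).

Definition factorizes (P : cube n -> R) (p : G -> R) : Prop :=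
  (forall g, 0 <= p g <= 1) /\
  (forall x, P x = \prod_(i < n) bern (p (config_of cs i x)) (x i)).

Variables (P : cube n -> R) (p : G -> R).
Hypothesis P_factorizes : factorizes P p.

Lemma factorizes_ge0 x : 0 <= P x.
Proof.
by case: P_factorizes => p01 ->; apply: prodr_ge0 => i _; exact: bern_ge0.
Qed.

Lemma sum_prod_config (K : G -> bool -> R) : (forall g, \sum_b K g b = 1) ->
  \sum_(x : cube n) \prod_(i < n) K (config_of cs i x) (x i) = 1.
Proof.
move=> K1; apply: (sum_prefix_kernel (K := fun i x => K (config_of cs i x))) => //.
by move=> i x y xy; rewrite (config_of_prefix cs xy).
Qed.

Lemma factorizes_sum1 : \sum_x P x = 1.
Proof.
case: P_factorizes => _ PE; under eq_bigr do rewrite PE.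
exact: (sum_prod_config (fun g => sum_bern (p g))).
Qed.

Lemma factorizes_distribution : is_distribution P.
Proof. by split; [exact: factorizes_ge0|exact: factorizes_sum1]. Qed.

Lemma factorizes_marginal g b :
  Pr P (fun x => hit g x && (hit_bit g x == b)) = hit_prob P g * bern (p g) b.
Proof.
case: P_factorizes => _ PE; pose K i x := bern (p (config_of cs i x)).
have K_prefix (i : 'I_n) : depends_on_prefix i (K i).
  by move=> x y xy; rewrite /K (config_of_prefix cs xy).
have hit_prefix : depends_on_prefix (node_of cs g) (fun x => (hit g x)%:R : R).
  by move=> x y xy; rewrite /hit (config_of_prefix cs xy).
have := sum_prefix_kernel_bit b K_prefix (fun i x => sum_bern _) hit_prefix.
rewrite /Pr /hit_prob /Pr [X in X * _]big_mkcond mulr_suml => marginal.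
rewrite (eq_bigl _ _ (fun x => andbC _ _)) big_mkcondr /=.
rewrite (eq_bigr (fun x => (hit g x)%:R * \prod_(i < n) K i x (x i))) => [|x _].
  rewrite marginal; apply: eq_bigr => x _; rewrite -PE /hit /K.
  by case: eqP => [->|_]; rewrite ?mul1r ?mul0r // mulrC.
by rewrite -PE; case: (hit g x); rewrite ?mul1r ?mul0r.
Qed.

Lemma prod_weight_unread (L : G -> bitseq) x :
  P x * ((\prod_g (agrees (L g) g x)%:R) * \prod_g weight (p g) (unread (L g) g x)) =
  (\prod_g weight (p g) (L g)) *
  \prod_(i < n) forced_bern (p (config_of cs i x)) (L (config_of cs i x)) (x i).
Proof.
case: P_factorizes => _ ->.
rewrite (big_hit _ (fun g => bern (p g))).
rewrite (big_hit _ (fun g => forced_bern (p g) (L g))).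
rewrite big_mkcond [X in _ = _ * X]big_mkcond -!big_split.
apply: eq_bigr => g _; rewrite /agrees /unread; case: ifP => /= _.
  exact: weight_forced.
by rewrite !mul1r mulr1.
Qed.

(* Reading a prescribed bit costs its Bernoulli weight; the conditional law of
   a sample given the prescribed bits is again a product of kernels, so that
   the remaining factor sums to 1. *)
Lemma iidE_tape_prefix_le m (L : G -> bitseq) :
  iidE P m (fun ws => \prod_g (prefix (L g) (tape g ws))%:R)
  <= \prod_g weight (p g) (L g).
Proof.
have [p01 _] := P_factorizes.
elim: m L => [|m IH] L /=.
  apply: ler_prod => g _; rewrite ler0n /=.
  by case: (L g) => [|b s] /=; rewrite ?weight_ge0 // /weight big_nil.
apply: (@le_trans _ _ (\sum_x P x * ((\prod_g (agrees (L g) g x)%:R) *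
    \prod_g weight (p g) (unread (L g) g x)))); last first.
  rewrite (eq_bigr _ (fun x _ => prod_weight_unread L x)).
  rewrite -mulr_sumr.
  rewrite (sum_prod_config (K := fun g => forced_bern (p g) (L g))) ?mulr1 //.
  by move=> g; exact: sum_forced_bern.
apply: ler_sum => x _; apply: ler_wpM2l; first exact: factorizes_ge0.
rewrite (eq_iidE (g := fun ws => (\prod_g (agrees (L g) g x)%:R) *
    \prod_g (prefix (unread (L g) g x) (tape g ws))%:R)) => [|ws _].
  by rewrite iidEZ; apply: ler_wpM2l; [apply: prodr_ge0 => g _; exact: ler0n|exact: IH].
rewrite -big_split; apply: eq_bigr => g _ /=.
by rewrite prefix_tape_cons -mulnb natrM.
Qed.

Variables (N : G -> nat) (Z : G -> bitseq -> R).

(* The configurations of [gs] are read by [Z], those outside [gs] have a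
   prescribed tape; the induction moves one configuration at a time from [gs]
   to the prescribed ones by summing over the bits read. *)
Lemma iidE_tapes_prefix_le phi m (gs : seq G) (L : G -> bitseq) a :
  (forall t, 0 <= phi t) -> uniq gs ->
  iidE P m (fun ws =>
    (\prod_(g | g \notin gs) (prefix (L g) (tape g ws))%:R) *
    ((\prod_(g <- gs) (N g <= size (tape g ws))%:R) *
     phi (a + \sum_(g <- gs) Z g (take (N g) (tape g ws)))))
  <= (\prod_(g | g \notin gs) weight (p g) (L g)) *
     indep_sumE (fun g => bern (p g)) N Z phi gs a.
Proof.
move=> phi0; have [p01 _] := P_factorizes.
elim: gs L a => [|g gs IH] L a /=.
  move=> _; rewrite (eq_iidE (g := fun ws =>
    phi a * \prod_g (prefix (L g) (tape g ws))%:R)) => [|ws _]; last first.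
    by rewrite !big_nil addr0 mul1r mulrC.
  by rewrite iidEZ [leRHS]mulrC; apply: ler_wpM2l => //; exact: iidE_tape_prefix_le.
case/andP=> ggs ugs.
pose L' y h := if h == g then y else L h.
have prodD1 (F : G -> bitseq -> R) y : \prod_(h | h \notin gs) F h (L' y h) =
    F g y * \prod_(h | h \notin g :: gs) F h (L h).
  rewrite (bigD1 g) //= {1}/L' eqxx; congr (_ * _).
  rewrite (eq_bigl (fun h => h \notin g :: gs)) => [|h]; last first.
    by rewrite inE negb_or andbC.
  by apply: eq_bigr => h; rewrite inE negb_or /L' => /andP[/negbTE->].
rewrite (iidE_density (bern (p g))) -iidEZ.
rewrite (eq_iidE (g := fun ws => iidE (fun=> 1) (N g) (fun y =>
  (\prod_(h | h \notin gs) (prefix (L' y h) (tape h ws))%:R) *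
    ((\prod_(h <- gs) (N h <= size (tape h ws))%:R) *
     phi (a + Z g y + \sum_(h <- gs) Z h (take (N h) (tape h ws))))))) => [|ws _].
  rewrite exchange_iidE; apply: ler_iidE => // y _; rewrite mulrA.
  by rewrite (mulrC _ (weight _ _)) -(prodD1 (fun h => weight (p h))); exact: IH.
pose f y := (\prod_(h | h \notin g :: gs) (prefix (L h) (tape h ws))%:R) *
    ((\prod_(h <- gs) (N h <= size (tape h ws))%:R) *
     phi (a + Z g y + \sum_(h <- gs) Z h (take (N h) (tape h ws)))).
transitivity ((N g <= size (tape g ws))%:R * f (take (N g) (tape g ws))).
  by rewrite !big_cons addrA /f; ring.
rewrite -iidE_prefix; apply: eq_iidE => y _.
by rewrite (prodD1 (fun h s => (prefix s (tape h ws))%:R)) -mulrA.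
Qed.

Lemma iidE_tapes_le phi m : (forall t, 0 <= phi t) ->
  iidE P m (fun ws =>
    (\prod_g (N g <= hits ws g)%:R) *
     phi (\sum_g Z g (take (N g) (tape g ws))))
  <= indep_sumE (fun g => bern (p g)) N Z phi (index_enum G) 0.
Proof.
move=> phi0.
have := iidE_tapes_prefix_le m (fun=> [::]) 0 phi0 (index_enum_uniq G).
rewrite [X in _ <= X * _]big1 => [|g]; last by rewrite mem_index_enum.
rewrite mul1r; apply: le_trans; apply: ler_iidE => [|ws _].
  exact: factorizes_ge0.
rewrite [X in _ <= X * _]big1 => [|g]; last by rewrite mem_index_enum.
by rewrite mul1r add0r; under [X in _ <= X * _]eq_bigr do rewrite size_tape.
Qed.

End Tapes.

(** * Moments of the pair statistic *)

Section PairStatistic.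
Variable R : realFieldType.
Implicit Types (p q : R) (y : bitseq).

Definition dev q (b : bool) : R := b%:R - q.

Definition dev_sum q y : R := \sum_(b <- y) dev q b.

(* The sum of [dev q y_k * dev q y_l] over the ordered pairs k <> l. *)
Definition pair_sum q y : R := dev_sum q y ^+ 2 - \sum_(b <- y) dev q b ^+ 2.

Lemma dev_sum_cons q b y : dev_sum q (b :: y) = dev q b + dev_sum q y.
Proof. by rewrite /dev_sum big_cons. Qed.

Lemma pair_sum_cons q b y :
  pair_sum q (b :: y) = pair_sum q y + 2 * dev q b * dev_sum q y.
Proof. by rewrite /pair_sum dev_sum_cons big_cons; ring. Qed.

Lemma dev_sum_count q y : dev_sum q y = (count id y)%:R - (size y)%:R * q.
Proof.
elim: y => [|b y IH]; first by rewrite /dev_sum big_nil /=; ring.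
by rewrite dev_sum_cons IH /= natrD -[(size y).+1%:R]natr1 /dev; ring.
Qed.

Lemma sum_sqr_dev q y : \sum_(b <- y) dev q b ^+ 2 =
  (count id y)%:R * (1 - 2 * q) + (size y)%:R * q ^+ 2.
Proof.
elim: y => [|b y IH]; first by rewrite big_nil /=; ring.
rewrite big_cons IH /= natrD -[(size y).+1%:R]natr1 /dev.
by case: b => /=; ring.
Qed.

Lemma pair_sum_count q y :
  pair_sum q y = ((count id y)%:R - (size y)%:R * q) ^+ 2
                 - (count id y)%:R * (1 - 2 * q) - (size y)%:R * q ^+ 2.
Proof. by rewrite /pair_sum dev_sum_count sum_sqr_dev; ring. Qed.

Lemma iidE_bern p N (f : bitseq -> R) :
  iidE (bern p) N.+1 f =
  p * iidE (bern p) N (fun y => f (true :: y)) +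
  (1 - p) * iidE (bern p) N (fun y => f (false :: y)).
Proof. by rewrite /= big_bool. Qed.

Section Moments.
Variables p q : R.
Let d := p - q.
Let v := p * (1 - p).

Lemma dev_sum_mean N : iidE (bern p) N (dev_sum q) = N%:R * d.
Proof.
elim: N => [|N IH]; first by rewrite /= /dev_sum big_nil mul0r.
have cond b : iidE (bern p) N (fun y => dev_sum q (b :: y)) = dev q b + N%:R * d.
  by rewrite (eq_iidE (fun y _ => dev_sum_cons q b y)) iidED iidE_cst ?sum_bern ?IH.
by rewrite iidE_bern !cond -natr1 /dev /d /=; ring.
Qed.

Lemma dev_sum_sqr_mean N :
  iidE (bern p) N (fun y => dev_sum q y ^+ 2) = N%:R * v + N%:R ^+ 2 * d ^+ 2.
Proof.
elim: N => [|N IH]; first by rewrite /= /dev_sum big_nil; ring.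
have cond b : iidE (bern p) N (fun y => dev_sum q (b :: y) ^+ 2) =
    N%:R * v + N%:R ^+ 2 * d ^+ 2 + (2 * dev q b * (N%:R * d) + dev q b ^+ 2).
  rewrite (eq_iidE (g := fun y =>
    dev_sum q y ^+ 2 + (2 * dev q b * dev_sum q y + dev q b ^+ 2))) => [|y _].
    by rewrite !iidED iidEZ iidE_cst ?sum_bern // IH dev_sum_mean.
  by rewrite dev_sum_cons; ring.
by rewrite iidE_bern !cond -natr1 /dev /d /v /=; ring.
Qed.

Lemma pair_sum_mean N :
  iidE (bern p) N (pair_sum q) = N%:R * (N%:R - 1) * d ^+ 2.
Proof.
elim: N => [|N IH]; first by rewrite /= /pair_sum /dev_sum !big_nil; ring.
have cond b : iidE (bern p) N (fun y => pair_sum q (b :: y)) =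
    N%:R * (N%:R - 1) * d ^+ 2 + 2 * dev q b * (N%:R * d).
  rewrite (eq_iidE (fun y _ => pair_sum_cons q b y)).
  by rewrite iidED iidEZ IH dev_sum_mean.
by rewrite iidE_bern !cond -natr1 /dev /d /=; ring.
Qed.

Lemma pair_sum_dev_sum_mean N :
  iidE (bern p) N (fun y => pair_sum q y * dev_sum q y) =
  N%:R ^+ 2 * (N%:R - 1) * d ^+ 3 + 2 * N%:R * (N%:R - 1) * d * v.
Proof.
elim: N => [|N IH]; first by rewrite /= /pair_sum /dev_sum !big_nil; ring.
have cond b : iidE (bern p) N (fun y => pair_sum q (b :: y) * dev_sum q (b :: y)) =
    N%:R ^+ 2 * (N%:R - 1) * d ^+ 3 + 2 * N%:R * (N%:R - 1) * d * v
    + (dev q b * (N%:R * (N%:R - 1) * d ^+ 2)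
    + (2 * dev q b * (N%:R * v + N%:R ^+ 2 * d ^+ 2)
    + 2 * dev q b ^+ 2 * (N%:R * d))).
  rewrite (eq_iidE (g := fun y => pair_sum q y * dev_sum q y
    + (dev q b * pair_sum q y
    + (2 * dev q b * dev_sum q y ^+ 2
    + 2 * dev q b ^+ 2 * dev_sum q y)))) => [|y _].
    by rewrite !iidED !iidEZ IH pair_sum_mean dev_sum_sqr_mean dev_sum_mean.
  by rewrite pair_sum_cons dev_sum_cons; ring.
by rewrite iidE_bern !cond -natr1 /dev /d /v /=; ring.
Qed.

Lemma pair_sum_sqr_mean N :
  iidE (bern p) N (fun y => pair_sum q y ^+ 2) =
  (N%:R * (N%:R - 1) * d ^+ 2) ^+ 2 + 2 * N%:R * (N%:R - 1) * v ^+ 2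
  + 4 * N%:R * (N%:R - 1) ^+ 2 * d ^+ 2 * v.
Proof.
elim: N => [|N IH]; first by rewrite /= /pair_sum /dev_sum !big_nil; ring.
have cond b : iidE (bern p) N (fun y => pair_sum q (b :: y) ^+ 2) =
    ((N%:R * (N%:R - 1) * d ^+ 2) ^+ 2 + 2 * N%:R * (N%:R - 1) * v ^+ 2
     + 4 * N%:R * (N%:R - 1) ^+ 2 * d ^+ 2 * v)
    + (4 * dev q b *
       (N%:R ^+ 2 * (N%:R - 1) * d ^+ 3 + 2 * N%:R * (N%:R - 1) * d * v)
    + 4 * dev q b ^+ 2 * (N%:R * v + N%:R ^+ 2 * d ^+ 2)).
  rewrite (eq_iidE (g := fun y => pair_sum q y ^+ 2
    + (4 * dev q b * (pair_sum q y * dev_sum q y)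
    + 4 * dev q b ^+ 2 * dev_sum q y ^+ 2))) => [|y _].
    by rewrite !iidED !iidEZ IH pair_sum_dev_sum_mean dev_sum_sqr_mean.
  by rewrite pair_sum_cons; ring.
by rewrite iidE_bern !cond -natr1 /dev /d /v /=; ring.
Qed.

End Moments.

Definition normalized_pair_sum q N y : R := pair_sum q y / (N%:R * (q * (1 - q))).

Definition chi2 p q : R := (p - q) ^+ 2 / (q * (1 - q)).

Definition pair_variance p q N : R :=
  (2 * N%:R * (N%:R - 1) * (p * (1 - p)) ^+ 2
   + 4 * N%:R * (N%:R - 1) ^+ 2 * (p - q) ^+ 2 * (p * (1 - p)))
  / (N%:R * (q * (1 - q))) ^+ 2.

Lemma chi2xx p : chi2 p p = 0.
Proof. by rewrite /chi2 subrr expr0n mul0r. Qed.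

Lemma normalized_pair_sum_mean p q N : (0 < N)%N -> 0 < q < 1 ->
  iidE (bern p) N (normalized_pair_sum q N) = (N%:R - 1) * chi2 p q.
Proof.
move=> N0 /andP[q0 q1].
rewrite (eq_iidE (g := fun y => (N%:R * (q * (1 - q)))^-1 * pair_sum q y)).
  rewrite iidEZ pair_sum_mean /chi2; field.
  by rewrite (gt_eqF q0) subr_eq0 (gt_eqF q1) pnatr_eq0 -lt0n N0.
by move=> y _; rewrite mulrC.
Qed.

Lemma normalized_pair_sum_sqr_mean p q N : (0 < N)%N -> 0 < q < 1 ->
  iidE (bern p) N (fun y => normalized_pair_sum q N y ^+ 2) =
  ((N%:R - 1) * chi2 p q) ^+ 2 + pair_variance p q N.
Proof.
move=> N0 /andP[q0 q1].
rewrite (eq_iidE (g := fun y => (N%:R * (q * (1 - q))) ^- 2 * pair_sum q y ^+ 2)).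
  rewrite iidEZ pair_sum_sqr_mean /chi2 /pair_variance; field.
  by rewrite (gt_eqF q0) subr_eq0 (gt_eqF q1) pnatr_eq0 -lt0n N0.
by move=> y _; rewrite /normalized_pair_sum expr_div_n mulrC.
Qed.

Lemma chi2_ge0 p q : 0 < q < 1 -> 0 <= chi2 p q.
Proof.
case/andP=> q0 q1; apply: divr_ge0; first exact: sqr_ge0.
by apply: mulr_ge0; rewrite ?subr_ge0 ltW.
Qed.

Lemma bern_variance_le p q : 0 <= p <= 1 -> 0 <= q <= 1 ->
  p * (1 - p) <= q * (1 - q) + `|p - q|.
Proof.
move=> /andP[p0 p1] /andP[q0 q1].
rewrite -lerBlDl (_ : _ - _ = (p - q) * (1 - p - q)); last by ring.
apply: (le_trans (ler_norm _)); rewrite normrM -[leRHS]mulr1.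
by apply: ler_wpM2l => //; rewrite ler_norml; lra.
Qed.

Lemma pair_variance_le_dev p q N (r := (q * (1 - q))^-1) :
  (0 < N)%N -> 0 < q < 1 -> 0 <= p <= 1 ->
  pair_variance p q N <=
  4 + 4 * (chi2 p q * r) + 4 * N%:R * chi2 p q * (1 + `|p - q| * r).
Proof.
move=> N0 q01 p01; have chi0 := chi2_ge0 p q01; have [q0 q1] := andP q01.
have [p0 p1] := andP p01.
have qq0 : 0 < q * (1 - q) by rewrite mulr_gt0 // subr_gt0.
have r0 : 0 < r by rewrite invr_gt0.
have N1 : 1 <= N%:R :> R by rewrite ler1n.
pose w := p * (1 - p) * r; pose t := `|p - q| * r.
have w0 : 0 <= w by rewrite !mulr_ge0 ?subr_ge0 // ltW.
have t0 : 0 <= t by rewrite mulr_ge0 // ltW.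
have wt : w <= 1 + t.
  rewrite (_ : 1 + t = (q * (1 - q) + `|p - q|) * r); last first.
    by rewrite mulrDl divff ?gt_eqF.
  apply: ler_wpM2r; first exact: ltW.
  by apply: bern_variance_le; rewrite ?p01 // !ltW.
have t2 : t ^+ 2 = chi2 p q * r.
  by rewrite exprMn real_normK ?num_real // /chi2 -/r; ring.
have -> : pair_variance p q N =
    2 * (1 - N%:R^-1) * w ^+ 2 + 4 * (N%:R - 1) ^+ 2 / N%:R * chi2 p q * w.
  rewrite /pair_variance /w /chi2 /r; field.
  by rewrite (gt_eqF q0) subr_eq0 (gt_eqF q1) pnatr_eq0 -lt0n N0.
apply: lerD.
  have w2 : w ^+ 2 <= (1 + t) ^+ 2 by rewrite ler_sqr ?nnegrE // addr_ge0.
  have : 2 * (1 - N%:R^-1) * w ^+ 2 <= 2 * w ^+ 2.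
    by apply: ler_wpM2r; rewrite ?sqr_ge0 // ler_piMr // gerBl invr_ge0 ler0n.
  rewrite -t2; have := sqr_ge0 (1 - t); lra.
apply: ler_pM => //; first by rewrite mulr_ge0 // divr_ge0 // mulr_ge0 ?sqr_ge0.
apply: ler_wpM2r => //; rewrite ler_pdivrMr ?ltr0n // -mulrA.
by apply: ler_wpM2l => //; nra.
Qed.

Lemma pair_variance_le (a H : R) p q N : 0 < a ->
  (0 < N)%N -> 0 < q < 1 -> 0 <= p <= 1 -> (q * (1 - q))^-1 <= H ->
  pair_variance p q N <=
  4 + N%:R * chi2 p q * (4 + (4 + 2 * a) * H) + 2 / a * (N%:R * chi2 p q) ^+ 2.
Proof.
move=> a0 N0 q01 p01; set r := _^-1 => rH.
apply: (le_trans (pair_variance_le_dev N0 q01 p01)); rewrite -/r.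
have [q0 q1] := andP q01; have x0 := chi2_ge0 p q01.
have r0 : 0 <= r by rewrite invr_ge0 mulr_ge0 ?subr_ge0 ?ltW.
have N1 : 1 <= N%:R :> R by rewrite ler1n.
pose x := chi2 p q; pose t := `|p - q| * r; rewrite -/x -/t in x0 *.
have t2 : t ^+ 2 = x * r.
  by rewrite exprMn real_normK ?num_real // /x /chi2 -/r; ring.
have Nx : x <= N%:R * x by rewrite ler_peMl.
have Nx0 : 0 <= N%:R * x by exact: le_trans Nx.
(* AM-GM: [2 t <= x / a + a r], since [t ^+ 2 = x r] *)
have amgm : 2 * t <= x / a + a * r.
  have xa0 : 0 <= x / a by rewrite divr_ge0 // ltW.
  have ar0 : 0 <= a * r by rewrite mulr_ge0 // ltW.
  have t0 : 0 <= 2 * t by rewrite !mulr_ge0.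
  rewrite -ler_sqr ?nnegrE ?addr_ge0 // exprMn t2.
  have : x / a * (a * r) = x * r by field; rewrite gt_eqF.
  have := sqr_ge0 (x / a - a * r); lra.
have := ler_wpM2l Nx0 amgm; have := ler_wpM2l Nx0 rH.
have := ler_wpM2r r0 Nx; have := ler_wpM2l Nx0 Nx.
have : 0 < a^-1 by rewrite invr_gt0.
rewrite -(mulrA 4 N%:R x).
move: (N%:R * x) Nx0 (a^-1) => y y0 b b0 yx xr yr yt.
have := ler_wpM2l (ltW a0) yr; have := ler_wpM2l (ltW b0) yx; lra.
Qed.

End PairStatistic.

(** * Chi-square bound on the distance *)

Lemma cauchy_schwarz_sum (R : realDomainType) (I : finType) (a b : I -> R) :
  (\sum_i a i * b i) ^+ 2 <= (\sum_i a i ^+ 2) * (\sum_i b i ^+ 2).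
Proof.
have : 0 <= \sum_i \sum_j (a i * b j - a j * b i) ^+ 2.
  by apply: sumr_ge0 => i _; apply: sumr_ge0 => j _; exact: sqr_ge0.
rewrite (eq_bigr (fun i => a i ^+ 2 * (\sum_j b j ^+ 2) +
  (b i ^+ 2 * (\sum_j a j ^+ 2) - 2 * (a i * b i) * (\sum_j a j * b j)))).
  by rewrite !big_split sumrN /= -!mulr_suml -mulr_sumr; lra.
move=> i _; rewrite !mulr_sumr -sumrB -big_split /=.
by apply: eq_bigr => j _; ring.
Qed.

Lemma sum_sqr_le (R : numDomainType) (I : finType) (x : I -> R) :
  (forall i, 0 <= x i) -> \sum_i x i ^+ 2 <= (\sum_i x i) ^+ 2.
Proof.
move=> x0; rewrite [leRHS]expr2 mulr_suml; apply: ler_sum => i _.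
by rewrite expr2; apply: ler_wpM2l => //; rewrite (bigD1 i) //= lerDl sumr_ge0.
Qed.

Section Distances.
Variables (R : realType) (n : nat) (P Q : cube n -> R).
Hypotheses (P_distr : is_distribution P) (Q_distr : is_distribution Q).

Lemma l1_dist_le2 : l1_dist P Q <= 2.
Proof.
have [[P0 P1] [Q0 Q1]] := (P_distr, Q_distr).
apply: (@le_trans _ _ (\sum_x (P x + Q x))); last by rewrite big_split /= P1 Q1.
by apply: ler_sum => x _; apply: (le_trans (ler_normB _ _)); rewrite !ger0_norm.
Qed.

Lemma l1_dist_sqr_le_hellinger :
  l1_dist P Q ^+ 2 <= 4 * \sum_x (Num.sqrt (P x) - Num.sqrt (Q x)) ^+ 2.
Proof.
have [[P0 P1] [Q0 Q1]] := (P_distr, Q_distr).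
have -> : l1_dist P Q = \sum_x `|Num.sqrt (P x) - Num.sqrt (Q x)| *
    (Num.sqrt (P x) + Num.sqrt (Q x)).
  apply: eq_bigr => x _; rewrite -{1}(sqr_sqrtr (P0 x)) -{1}(sqr_sqrtr (Q0 x)).
  by rewrite subr_sqr normrM [X in _ * X]ger0_norm // addr_ge0 ?sqrtr_ge0.
apply: (le_trans (cauchy_schwarz_sum _ _)); rewrite mulrC.
under [X in _ * X]eq_bigr do rewrite real_normK ?num_real //.
apply: ler_wpM2r; first by apply: sumr_ge0 => x _; exact: sqr_ge0.
apply: (@le_trans _ _ (\sum_x 2 * (P x + Q x))).
  apply: ler_sum => x _; rewrite -{2}(sqr_sqrtr (P0 x)) -{2}(sqr_sqrtr (Q0 x)).
  by have := sqr_ge0 (Num.sqrt (P x) - Num.sqrt (Q x)); lra.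
by rewrite -mulr_sumr big_split /= P1 Q1; lra.
Qed.

End Distances.

Section ChiSquareBound.
Variables (R : realType) (n : nat) (G : finType) (cs : config_system n G).
Variables (P Q : cube n -> R) (p q : G -> R).
Hypotheses (P_factorizes : factorizes cs P p) (Q_factorizes : factorizes cs Q q).
Hypothesis q_itv : forall g, 0 < q g < 1.

Lemma expect_node_sum (F : G -> bool -> R) :
  \sum_x P x * (\sum_i F (config_of cs i x) (x i)) =
  \sum_g hit_prob cs P g * \sum_b bern (p g) b * F g b.
Proof.
under eq_bigr do rewrite big_hit mulr_sumr.
rewrite (exchange_big_dep xpredT) //=; apply: eq_bigr => g _.
rewrite (partition_big (hit_bit cs g) xpredT) //= mulr_sumr; apply: eq_bigr => b _.
rewrite mulrA -(factorizes_marginal P_factorizes) mulr_suml.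
by apply: eq_bigr => x /andP[_ /eqP ->].
Qed.

Definition node_excess x : R :=
  \sum_i (bern (p (config_of cs i x)) (x i) / bern (q (config_of cs i x)) (x i) - 1).

Lemma sum_bern_excess (r s : R) : 0 < s < 1 ->
  \sum_b bern r b * (bern r b / bern s b - 1) = chi2 r s.
Proof.
case/andP=> s0 s1; rewrite big_bool /bern /chi2 /=; field.
by rewrite (gt_eqF s0) subr_eq0 (gt_eqF s1).
Qed.

Lemma expect_node_excess :
  \sum_x P x * node_excess x = \sum_g hit_prob cs P g * chi2 (p g) (q g).
Proof.
rewrite /node_excess (expect_node_sum (fun g b => bern (p g) b / bern (q g) b - 1)).
by apply: eq_bigr => g _; rewrite sum_bern_excess.
Qed.

Lemma likelihood_le x : P x <= Q x * expR (node_excess x).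
Proof.
have [[p01 PE] [_ QE]] := (P_factorizes, Q_factorizes).
rewrite PE QE /node_excess expR_sum -big_split /=; apply: ler_prod => i _.
rewrite bern_ge0 //=; set r := bern _ _; set s := bern _ _.
have s0 : 0 < s.
  rewrite /s /bern; case/andP: (q_itv (config_of cs i x)) => q0 q1.
  by case: ifP; rewrite ?subr_gt0.
rewrite mulrC -ler_pdivrMr //; apply: le_trans (expR_ge1Dx _).
by rewrite addrC subrK.
Qed.

(* [P sqrt (Q / P) >= P exp (- e / 2) >= P (1 - e / 2)] for the excess e. *)
Lemma hellinger_term_le x :
  (Num.sqrt (P x) - Num.sqrt (Q x)) ^+ 2 <= Q x - P x + P x * node_excess x.
Proof.
have P0 := factorizes_ge0 P_factorizes x; have Q0 := factorizes_ge0 Q_factorizes x.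
set e := node_excess x.
suff : P x * (1 - e / 2) <= Num.sqrt (P x) * Num.sqrt (Q x).
  by rewrite sqrrB !sqr_sqrtr //; lra.
apply: (@le_trans _ _ (P x * expR (- (e / 2)))).
  by apply: ler_wpM2l => //; exact: expR_ge1Dx.
rewrite -sqrtrM // -[leLHS]ger0_norm ?mulr_ge0 ?expR_ge0 // -sqrtr_sqr.
apply: ler_wsqrtr; rewrite exprMn expr2 -mulrA; apply: ler_wpM2l => //.
have -> : expR (- (e / 2)) ^+ 2 = expR (- e).
  by rewrite -expRM_natl; congr expR; lra.
by rewrite expRN -ler_pdivlMr ?invr_gt0 ?expR_gt0 // invrK likelihood_le.
Qed.

Lemma l1_dist_sqr_le_chi2 :
  l1_dist P Q ^+ 2 <= 4 * \sum_g hit_prob cs P g * chi2 (p g) (q g).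
Proof.
have P_distr := factorizes_distribution P_factorizes.
have Q_distr := factorizes_distribution Q_factorizes.
apply: (le_trans (l1_dist_sqr_le_hellinger P_distr Q_distr)).
apply: ler_wpM2l => //; apply: (le_trans (ler_sum _ (fun x _ => hellinger_term_le x))).
have [[_ P1] [_ Q1]] := (P_distr, Q_distr).
by rewrite big_split /= sumrB P1 Q1 expect_node_excess subrr add0r.
Qed.

End ChiSquareBound.

(** * Error probabilities of the test *)

Section HitCounts.
Variables (R : realType) (n : nat) (G : finType) (cs : config_system n G).
Variables (P : cube n -> R) (p : G -> R).
Hypothesis P_factorizes : factorizes cs P p.

Let P_ge0 := factorizes_ge0 P_factorizes.
Let P_sum1 := factorizes_sum1 P_factorizes.
Local Notation pi := (hit_prob cs P).

Lemma hits_gen_fun_le k g (a : R) : 0 <= a ->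
  iidE P k (fun ws => a ^+ hits cs ws g) <= expR (k%:R * ((a - 1) * pi g)).
Proof.
move=> a0.
rewrite (eq_iidE (g := fun ws => \prod_(x <- ws) (if hit cs g x then a else 1))).
  rewrite iidE_prod expRM_natl; apply: lerXn2r; rewrite ?nnegrE ?expR_ge0 //.
    by apply: sumr_ge0 => x _; rewrite mulr_ge0 //; case: ifP.
  apply: le_trans (expR_ge1Dx _); rewrite -lerBlDl -[X in _ - X]P_sum1 -sumrB.
  rewrite /hit_prob /Pr [X in _ <= _ * X]big_mkcond mulr_sumr; apply: ler_sum => x _ /=.
  by case: ifP => _; lra.
move=> ws _; rewrite /hits.
elim: ws => [|x ws IH]; rewrite ?big_nil ?big_cons //= -IH exprD.
by case: (hit cs g x); rewrite ?expr1 ?expr0.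
Qed.

Lemma few_hits_le k g (s : R) :
  iidPr P k (fun ws => (hits cs ws g)%:R < s) <=
  2 `^ s * expR (- (k%:R * (pi g / 2))).
Proof.
have half_powR h : 2^-1 ^+ h = 2 `^ (- h%:R) :> R.
  by rewrite powRN powR_mulrn // exprVn.
have := iidPr_markov P_ge0 (m := k) (E := fun ws => (hits cs ws g)%:R < s)
  (f := fun ws => 2^-1 ^+ hits cs ws g) (c := 2 `^ (- s)).
rewrite powRN invrK mulrC => markov; apply: (le_trans (markov _ _ _)).
- by rewrite invr_gt0 powR_gt0.
- by move=> ws; rewrite exprn_ge0 // invr_ge0.
- move=> ws _ lt; rewrite -powRN half_powR; apply: ler_powR; first by lra.
  by rewrite lerN2 ltW.
apply: ler_wpM2l; first exact: powR_ge0.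
apply: (le_trans (hits_gen_fun_le k g _)); first by lra.
by rewrite ler_expR -mulrN; apply: ler_wpM2l => //; lra.
Qed.

Lemma shortfall_le k l g :
  iidPr P (k + l) (fun ws => (hits cs (drop k ws) g < hits cs (take k ws) g)%N) <=
  expR ((k%:R - l%:R / 2) * pi g).
Proof.
rewrite (iidPr_cat _ k l (fun s1 s2 => (hits cs s2 g < hits cs s1 g)%N)).
apply: (@le_trans _ _ (iidE P k (fun s1 =>
    expR (- (l%:R * (pi g / 2))) * 2 ^+ hits cs s1 g))).
  apply: ler_iidE => // s1 _; rewrite mulrC -powR_mulrn //.
  apply: le_trans (few_hits_le l g (hits cs s1 g)%:R).
  by apply: iidPr_le => // s2 _; rewrite ltr_nat.
rewrite iidEZ; apply: (@le_trans _ _ (expR (- (l%:R * (pi g / 2))) *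
   expR (k%:R * ((2 - 1) * pi g)))).
  by apply: ler_wpM2l; rewrite ?expR_ge0 // hits_gen_fun_le.
by rewrite -expRD ler_expR; lra.
Qed.

End HitCounts.

Section Test.
Variables (R : realType) (n : nat) (G : finType) (cs : config_system n G).
Variables (q : G -> R) (m tau : nat) (eps : R).
Implicit Types (N : G -> nat) (ws : seq (cube n)).

Definition enough N ws : bool :=
  [forall g, (tau <= N g)%N && (N g <= hits cs ws g)%N].

Definition statistic N ws : R :=
  \sum_g normalized_pair_sum (q g) (N g) (take (N g) (tape cs g ws)).

Definition decide ws1 ws2 : bool :=
  enough (hits cs ws1) ws2 && (64 * statistic (hits cs ws1) ws2 <= m%:R * eps ^+ 2).

Definition accept ws : bool := decide (take m ws) (drop m ws).

Lemma enough_ge N ws g : enough N ws -> (tau <= N g)%N.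
Proof. by move=> /forallP/(_ g)/andP[]. Qed.

Hypothesis q_itv : forall g, 0 < q g < 1.

Lemma chebyshev_statistic (P : cube n -> R) (p : G -> R) N k (b c : R) (E : pred R) :
  factorizes cs P p -> (forall g, 0 < N g)%N -> 0 < c ->
  (forall t, E t -> c <= (t - b) ^+ 2) ->
  iidPr P k (fun ws => enough N ws && E (statistic N ws)) <=
  (\sum_g pair_variance (p g) (q g) (N g) +
   (\sum_g ((N g)%:R - 1) * chi2 (p g) (q g) - b) ^+ 2) / c.
Proof.
move=> PF N0 c0 Ec.
pose f ws := (\prod_g (N g <= hits cs ws g)%:R) * (statistic N ws - b) ^+ 2.
have prod_ge0 ws : 0 <= \prod_g (N g <= hits cs ws g)%:R :> R.
  by apply: prodr_ge0 => g _; exact: ler0n.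
have := iidPr_markov (factorizes_ge0 PF) (m := k) (f := f) c0.
move=> /(_ (fun ws => enough N ws && E (statistic N ws))) markov.
apply: (le_trans (markov _ _)) => [ws|ws _ /andP[/forallP en Et]|].
- by rewrite mulr_ge0 ?sqr_ge0.
- rewrite /f big1 => [|g _]; last by case/andP: (en g) => _ ->.
  by rewrite mul1r; exact: Ec.
apply: ler_wpM2r; first by rewrite invr_ge0 ltW.
have := iidE_tapes_le PF N (fun g => normalized_pair_sum (q g) (N g)) k
  (fun t => sqr_ge0 (t - b)).
rewrite (indep_sumE_sqr (mean := fun g => ((N g)%:R - 1) * chi2 (p g) (q g))
  (var := fun g => pair_variance (p g) (q g) (N g))) ?add0r //.
- by move=> g; exact: sum_bern.
- by move=> g; exact: normalized_pair_sum_mean.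
- by move=> g; exact: normalized_pair_sum_sqr_mean.
Qed.

Local Notation root := (Num.sqrt #|G|%:R : R).

Hypothesis G_gt0 : (0 < #|G|)%N.
Hypothesis q_balanced : forall g, (q g * (1 - q g))^-1 <= root / 1000.
Hypothesis m_large : 100 ^+ 2 * root <= m%:R * eps ^+ 2.
Hypothesis tau_ge2 : (2 <= tau)%N.

Lemma root_ge1 : 1 <= root.
Proof. by rewrite -[leLHS]sqrtr1; apply: ler_wsqrtr; rewrite ler1n. Qed.

Lemma root_sqr : root ^+ 2 = #|G|%:R.
Proof. by rewrite sqr_sqrtr. Qed.

Lemma sum_cst_root (a : R) : \sum_(g : G) a = a * root ^+ 2.
Proof. by rewrite root_sqr mulr_natr sumr_const. Qed.

Section Completeness.
Variable Q : cube n -> R.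
Hypothesis Q_factorizes : factorizes cs Q q.

Let Q_ge0 := factorizes_ge0 Q_factorizes.
Let Q_sum1 := factorizes_sum1 Q_factorizes.

Lemma large_statistic_le N k :
  iidPr Q k (fun ws => enough N ws && (m%:R * eps ^+ 2 < 64 * statistic N ws))
  <= 1 / 10.
Proof.
have root1 := root_ge1; have mL := m_large.
have [/forallP N_tau|/forallPn[g ng]] := boolP [forall g, (tau <= N g)%N]; last first.
  rewrite iidPr_eq0 => [|ws _]; first by lra.
  by apply: contra ng => /andP[/enough_ge].
have N0 g : (0 < N g)%N by apply: leq_trans (N_tau g); exact: ltnW.
have c0 : 0 < (m%:R * eps ^+ 2 / 64) ^+ 2 by rewrite exprn_gt0 //; lra.
have large_sqr t : m%:R * eps ^+ 2 < 64 * t ->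
    (m%:R * eps ^+ 2 / 64) ^+ 2 <= (t - 0) ^+ 2.
  by move=> lt; rewrite subr0 ler_sqr ?nnegrE; lra.
apply: (le_trans (chebyshev_statistic k Q_factorizes N0 c0 large_sqr)).
rewrite [X in _ + X](_ : _ = 0) ?addr0; last first.
  by rewrite big1 ?subrr ?expr0n // => g _; rewrite chi2xx mulr0.
rewrite ler_pdivrMr //; apply: (@le_trans _ _ (\sum_(g : G) 4)).
  apply: ler_sum => g _; have [q0 q1] := andP (q_itv g).
  have q_itvW : 0 <= q g <= 1 by rewrite !ltW.
  apply: (le_trans (pair_variance_le ltr01 (N0 g) (q_itv g) q_itvW (q_balanced g))).
  by rewrite chi2xx mulr0 mul0r expr0n mulr0 !addr0.
rewrite sum_cst_root.
have : (100 * root) ^+ 2 <= (m%:R * eps ^+ 2 / 64) ^+ 2 by rewrite ler_sqr ?nnegrE; lra.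
by have := sqr_ge0 root; rewrite exprMn; lra.
Qed.

Hypothesis hits_likely : forall g,
  (2 ^+ tau + 1) * expR (- (m%:R * (hit_prob cs Q g / 2))) <= (10 * #|G|%:R)^-1.

Lemma short_counts_le :
  \sum_g (iidPr Q (m + 3 * m) (fun ws => (hits cs (take m ws) g < tau)%N) +
    iidPr Q (m + 3 * m) (fun ws => (hits cs (drop m ws) g < hits cs (take m ws) g)%N))
  <= 1 / 10.
Proof.
apply: (@le_trans _ _ (\sum_(g : G) (10 * #|G|%:R)^-1)); last first.
  rewrite sum_cst_root root_sqr invfM -mulrA mulVf ?pnatr_eq0 -?lt0n //.
  by rewrite mulr1 mul1r.
apply: ler_sum => g _; apply: le_trans (hits_likely g); rewrite mulrDl mul1r.
apply: lerD; last first.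
  by apply: (le_trans (shortfall_le Q_factorizes _ _ _)); rewrite ler_expR natrM; lra.
rewrite (iidPr_take Q_sum1 m _ (fun ws => (hits cs ws g < tau)%N)).
rewrite -(powR_mulrn tau) //; apply: le_trans (few_hits_le Q_factorizes _ _ _).
by apply: iidPr_le => // ws _; rewrite ltr_nat.
Qed.

Lemma reject_prob_le : iidPr Q (m + 3 * m) (predC accept) <= 1 / 3.
Proof.
pose below g ws := (hits cs (take m ws) g < tau)%N.
pose short g ws := (hits cs (drop m ws) g < hits cs (take m ws) g)%N.
pose large s1 s2 := enough (hits cs s1) s2 &&
  (m%:R * eps ^+ 2 < 64 * statistic (hits cs s1) s2).
pose large_at ws := large (take m ws) (drop m ws).
apply: (@le_trans _ _ (iidPr Q (m + 3 * m) (predU (predU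
    (fun ws => [exists g, below g ws]) (fun ws => [exists g, short g ws])) large_at))).
  apply: iidPr_le => // ws _; rewrite /= /accept /decide /large_at /large ltNge.
  case: (boolP (enough _ _)) => [_ /= -> |/forallPn[g]]; first by rewrite orbT.
  rewrite negb_and -!ltnNge => /orP[lt|lt] _; apply/orP; left; apply/orP.
    by left; apply/existsP; exists g.
  by right; apply/existsP; exists g.
apply: (le_trans (iidPrU Q_ge0 _ _ _)).
have large_le : iidPr Q (m + 3 * m) large_at <= 1 / 10.
  by apply: iidPr_cat_le => // s1 _; exact: large_statistic_le.
have := iidPrU Q_ge0 (m + 3 * m) (fun ws => [exists g, below g ws])
  (fun ws => [exists g, short g ws]).
have := iidPr_exists Q_ge0 (m + 3 * m) below.
have := iidPr_exists Q_ge0 (m + 3 * m) short.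
have := short_counts_le; rewrite big_split /=; lra.
Qed.

End Completeness.

Section Soundness.
Variables (P Q : cube n -> R) (p : G -> R).
Hypotheses (P_factorizes : factorizes cs P p) (Q_factorizes : factorizes cs Q q).
Hypothesis eps_gt0 : 0 < eps.
Hypothesis far : eps < l1_dist P Q.

Let P_ge0 := factorizes_ge0 P_factorizes.
Let P_sum1 := factorizes_sum1 P_factorizes.
Local Notation pi := (hit_prob cs P).

Definition underrepresented ws g : bool :=
  (tau <= hits cs ws g)%N && ((hits cs ws g)%:R < m%:R * pi g / 4).

Lemma underrepresented_le g :
  iidPr P m (fun ws => underrepresented ws g) <= expR (- tau%:R).
Proof.
have [le|lt] := leP (m%:R * pi g / 4) tau%:R.
  rewrite iidPr_eq0 ?expR_ge0 // => ws _; rewrite negb_and -ltnNge -leNgt.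
  by case: ltnP => //= tau_le; rewrite (le_trans le) // ler_nat.
apply: (@le_trans _ _ (2 `^ (m%:R * pi g / 4) * expR (- (m%:R * (pi g / 2))))).
  apply: le_trans (few_hits_le P_factorizes _ _ _).
  by apply: iidPr_le => // ws _ /andP[].
have s0 : 0 <= m%:R * pi g / 4 by exact: le_trans (ltW lt).
have : m%:R * pi g / 4 * ln 2 <= m%:R * pi g / 4.
  by rewrite ler_piMr // -ler_expR lnK ?posrE //; have := expR_ge1Dx (1 : R); lra.
by rewrite /powR pnatr_eq0 -expRD ler_expR; lra.
Qed.

Section GoodCounts.
Variable N : G -> nat.
Hypothesis N_tau : forall g, (tau <= N g)%N.
Hypothesis N_hits : forall g, m%:R * pi g / 4 <= (N g)%:R.

Let x g := chi2 (p g) (q g).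
Let mean := \sum_g ((N g)%:R - 1) * x g.
Let X := \sum_g (N g)%:R * x g.

Let x_ge0 g : 0 <= x g.
Proof. exact: chi2_ge0. Qed.

Let N_ge2 g : 2 <= (N g)%:R :> R.
Proof. by rewrite ler_nat (leq_trans tau_ge2). Qed.

Let X_le_mean : X <= 2 * mean.
Proof.
rewrite mulr_sumr; apply: ler_sum => g _; rewrite mulrA; apply: ler_wpM2r => //.
by have := N_ge2 g; lra.
Qed.

Lemma statistic_mean_ge : m%:R * eps ^+ 2 <= 32 * mean.
Proof.
have e0 := eps_gt0.
have eps2 : eps ^+ 2 <= 4 * \sum_g pi g * x g.
  apply: le_trans (l1_dist_sqr_le_chi2 P_factorizes Q_factorizes q_itv).
  by rewrite ler_sqr ?nnegrE; have := far; lra.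
apply: (le_trans (ler_wpM2l (ler0n R m) eps2)).
apply: (@le_trans _ _ (16 * X)); last by have := X_le_mean; lra.
rewrite !mulr_sumr; apply: ler_sum => g _.
by have := ler_wpM2r (x_ge0 g) (N_hits g); lra.
Qed.

Lemma statistic_variance_le :
  \sum_g pair_variance (p g) (q g) (N g) <= 3 / 10 * (mean ^+ 2 / 4).
Proof.
have root1 := root_ge1; have mean_ge := statistic_mean_ge; have mL := m_large.
have [p_itv _] := P_factorizes; have XE := X_le_mean.
have X0 : 0 <= X by apply: sumr_ge0 => g _; rewrite mulr_ge0.
have root_le : 300 * root <= mean by lra.
apply: (@le_trans _ _ (\sum_g (4 + ((N g)%:R * x g * (4 + 644 * (root / 1000)) +
    1 / 160 * ((N g)%:R * x g) ^+ 2)))).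
  apply: ler_sum => g _.
  have N0 : (0 < N g)%N by apply: leq_trans (N_tau g); exact: ltnW.
  have a0 : 0 < 320 :> R by rewrite ltr0n.
  apply: (le_trans (pair_variance_le a0 N0 (q_itv g) (p_itv g) (q_balanced g))).
  by rewrite -/(x g); lra.
rewrite !big_split /= sum_cst_root -mulr_suml -mulr_sumr -/X.
have sum_sqr : \sum_g ((N g)%:R * x g) ^+ 2 <= X ^+ 2.
  by apply: sum_sqr_le => g; rewrite mulr_ge0.
have X_sqr : X ^+ 2 <= (2 * mean) ^+ 2 by rewrite ler_sqr ?nnegrE; lra.
have root_sqr_le : (300 * root) ^+ 2 <= mean ^+ 2 by rewrite ler_sqr ?nnegrE; lra.
have root_mean : 300 * root * mean <= mean * mean by apply: ler_wpM2r; lra.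
have mean_le : 300 * mean <= mean * mean by apply: ler_wpM2r; lra.
have : X * (4 + 644 * (root / 1000)) <= 2 * mean * (4 + 644 * (root / 1000)).
  by apply: ler_wpM2r; lra.
rewrite !exprMn in X_sqr root_sqr_le; lra.
Qed.

Lemma small_statistic_le k :
  iidPr P k (fun ws => enough N ws && (64 * statistic N ws <= m%:R * eps ^+ 2))
  <= 3 / 10.
Proof.
have mean_ge := statistic_mean_ge; have mL := m_large; have root1 := root_ge1.
have N0 g : (0 < N g)%N by apply: leq_trans (N_tau g); exact: ltnW.
have c0 : 0 < mean ^+ 2 / 4 by rewrite divr_gt0 // exprn_gt0 //; lra.
have small_sqr t : 64 * t <= m%:R * eps ^+ 2 -> mean ^+ 2 / 4 <= (t - mean) ^+ 2.
  move=> le; have : (mean / 2) ^+ 2 <= (mean - t) ^+ 2 by rewrite ler_sqr ?nnegrE; lra.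
  lra.
apply: (le_trans (chebyshev_statistic k P_factorizes N0 c0 small_sqr)).
rewrite subrr expr0n addr0 ler_pdivrMr //; exact: statistic_variance_le.
Qed.

End GoodCounts.

Hypothesis tau_large : #|G|%:R * expR (- tau%:R) <= 1 / 100 :> R.

Lemma accept_prob_le : iidPr P (m + 3 * m) accept <= 1 / 3.
Proof.
pose under ws := [exists g, underrepresented ws g].
pose good s1 s2 := ~~ under s1 && decide s1 s2.
have good_le s1 : iidPr P (3 * m) (good s1) <= 3 / 10.
  have [le|nle] :=
      boolP (~~ under s1 && [forall g, (tau <= hits cs s1 g)%N]); last first.
    rewrite iidPr_eq0 => [|s2 _]; first by lra.
    apply: contra nle => /and3P[-> en _]; apply/forallP => g; exact: enough_ge en.
  have [/existsPn nu /forallP N_tau] := andP le.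
  have N_hits g : m%:R * pi g / 4 <= (hits cs s1 g)%:R.
    by have := nu g; rewrite /underrepresented N_tau /= -leNgt.
  apply: le_trans (small_statistic_le N_tau N_hits (3 * m)).
  by apply: iidPr_le => // s2 _ /andP[].
have split ws : accept ws -> under (take m ws) || good (take m ws) (drop m ws).
  by move=> acc; rewrite /good; case: (under _).
apply: (le_trans (iidPr_le P_ge0 (fun ws _ => @split ws))).
apply: (le_trans (iidPrU P_ge0 _ (fun ws => under (take m ws))
  (fun ws => good (take m ws) (drop m ws)))).
rewrite (iidPr_take P_sum1 _ _ under).
have := iidPr_cat_le P_ge0 P_sum1 (fun s1 (_ : size s1 = m) => good_le s1).
have : iidPr P m under <= \sum_(g : G) expR (- tau%:R).
  apply: (le_trans (iidPr_exists P_ge0 m (fun g ws => underrepresented ws g))).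
  by apply: ler_sum => g _; exact: underrepresented_le.
by rewrite sum_cst_root root_sqr; have := tau_large; lra.
Qed.

End Soundness.
End Test.

(** * Execution of programs *)

Section Execution.
Variables (R : realType) (smp : nat -> bitseq) (coin : nat -> bool).
Local Notation step := (@step R smp coin).
Implicit Types (s : state R) (c : cmd) (Post : state R -> Prop).

Definition runs c s K Post : Prop := exists s' k,
  [/\ (k <= K)%N, forall ks, iter k step (c :: ks, s) = (ks, s') & Post s'].

Lemma runs_weaken c s K K' Post Post' :
  (K <= K')%N -> (forall s', Post s' -> Post' s') ->
  runs c s K Post -> runs c s K' Post'.
Proof.
move=> KK' PP' [s' [k [kK exec /PP' post]]]; exists s', k; split=> //.
exact: leq_trans KK'.
Qed.

Lemma runs_leq c s K K' Post : (K <= K')%N -> runs c s K Post -> runs c s K' Post.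
Proof. by move=> KK'; apply: runs_weaken. Qed.

Lemma runs_seq c1 c2 s K1 K2 Post :
  runs c1 s K1 (fun s1 => runs c2 s1 K2 Post) ->
  runs (Seq c1 c2) s (K1 + K2).+1 Post.
Proof.
move=> [s1 [k1 [kK1 exec1 [s2 [k2 [kK2 exec2 post]]]]]].
exists s2, (k2 + k1).+1; split=> //; first by rewrite ltnS addnC leq_add.
by move=> ks; rewrite iterSr iterD /= exec1 exec2.
Qed.

Lemma runs_if b c1 c2 s K Post :
  runs (if beval s b then c1 else c2) s K Post -> runs (If b c1 c2) s K.+1 Post.
Proof.
move=> [s' [k [kK exec post]]]; exists s', k.+1; split=> // ks.
by rewrite iterSr /= exec.
Qed.

Lemma runs_while b c (Inv : nat -> state R -> Prop) M K :
  (forall j s, (j < M)%N -> Inv j s -> beval s b /\ runs c s K (Inv j.+1)) ->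
  (forall s, Inv M s -> ~~ beval s b) ->
  forall s, Inv 0 s -> runs (While b c) s (M * K.+1).+1 (Inv M).
Proof.
move=> loop stop.
suff remaining d s : (d <= M)%N -> Inv (M - d)%N s ->
    runs (While b c) s (d * K.+1).+1 (Inv M).
  by move=> s inv0; apply: remaining => //; rewrite subnn.
elim: d s => [|d IH] s dM.
  rewrite subn0 => invM; exists s, 1; split=> // ks /=.
  by rewrite (negbTE (stop s invM)).
move=> inv; have lt : (M - d.+1 < M)%N by rewrite ltn_subrL (leq_ltn_trans _ dM).
have [bs [s1 [k1 [kK1 exec1 inv1]]]] := loop _ s lt inv.
rewrite subnSK // in inv1.
have [s2 [k2 [kK2 exec2 post]]] := IH s1 (ltnW dM) inv1.
exists s2, (k2 + k1).+1; split=> //; first by rewrite mulSn; lia.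
by move=> ks; rewrite iterSr iterD /= bs exec1 exec2.
Qed.

Lemma runs_run prog (inp : input R) K t Post :
  runs prog (init inp) K Post -> (K <= t)%N ->
  exists2 s', run prog inp smp coin t = ([::], s') & Post s'.
Proof.
move=> [s' [k [kK exec post]]] Kt; exists s' => //.
by rewrite /run -(subnK (leq_trans kK Kt)) iterD exec iter_fix.
Qed.

Fixpoint straight c : bool :=
  match c with
  | Seq c1 c2 | If _ c1 c2 => straight c1 && straight c2
  | While _ _ => false
  | _ => true
  end.

Fixpoint effect c s : state R :=
  match c with
  | Skip | While _ _ => s
  | Seq c1 c2 => effect c2 (effect c1 s)
  | If b c1 c2 => if beval s b then effect c1 s else effect c2 s
  | _ => (step ([:: c], s)).2
  end.

Fixpoint cost c : nat :=
  match c with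
  | Seq c1 c2 | If _ c1 c2 => (cost c1 + cost c2).+1
  | _ => 1
  end.

Lemma runs_straight c s Post :
  straight c -> Post (effect c s) -> runs c s (cost c) Post.
Proof.
elim: c s Post => [|X e v|X e v|X e|X e|c1 IH1 c2 IH2|b c1 IH1 c2 IH2|//] s Post /=;
  try by move=> _ post; eexists _, 1; split; [|move=> ks /=; reflexivity|exact: post].
- by case/andP=> s1 s2 post; apply: runs_seq; apply: IH1 => //; exact: IH2.
- case/andP=> s1 s2 post; apply: runs_if; case: ifP post => _ post.
    by apply: runs_weaken (IH1 _ _ s1 post) => //; rewrite leq_addr.
  by apply: runs_weaken (IH2 _ _ s2 post) => //; rewrite leq_addl.
Qed.

Fixpoint atoms c : seq cmd :=
  match c with
  | Seq c1 c2 | If _ c1 c2 => atoms c1 ++ atoms c2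
  | While _ c1 => atoms c1
  | _ => [:: c]
  end.

Lemma iter_step_invariant (p : pred cmd) (V : Type) (f : state R -> V) :
  (forall c s, p c -> f (step ([:: c], s)).2 = f s) ->
  forall k ks s, all (fun c => all p (atoms c)) ks -> f (iter k step (ks, s)).2 = f s.
Proof.
move=> pf; elim=> [//|k IH] ks s; rewrite iterSr.
case: ks => [|c ks] /=; first by rewrite IH.
case/andP=> pc pks.
case: c pc => [|X e v|X e v|X e|X e|c1 c2|b c1 c2|b c1] /= pc;
  try by rewrite IH // -[RHS](pf _ s (proj1 (andP pc))).
- by rewrite IH //= pks andbT -all_cat.
- by rewrite IH //= pks andbT; move: pc; rewrite all_cat => /andP[]; case: ifP.
- by rewrite IH //; case: ifP => _ //=; rewrite pks pc.
Qed.

Definition writes_nat X c : bool :=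
  match c with NStore Y _ _ | Draw Y _ | Flip Y _ => Y == X | _ => false end.

Definition writes_real X c : bool := if c is RStore Y _ _ then Y == X else false.

Definition draws c : bool := if c is Draw _ _ then true else false.

Definition keeps_nat X c : bool := all (predC (writes_nat X)) (atoms c).
Definition keeps_real X c : bool := all (predC (writes_real X)) (atoms c).
Definition keeps_drawn c : bool := all (predC draws) (atoms c).

Record frame c s s' : Prop := Frame {
  frame_nat : forall X j, keeps_nat X c -> nmem s' X j = nmem s X j;
  frame_real : forall X j, keeps_real X c -> rmem s' X j = rmem s X j;
  frame_drawn : keeps_drawn c -> drawn s' = drawn s }.

Lemma runs_frame c s K Post :
  runs c s K Post -> runs c s K (fun s' => Post s' /\ frame c s s').
Proof.
move=> [s' [k [kK exec post]]]; exists s', k; split=> //; split=> //.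
have -> : s' = (iter k step ([:: c], s)).2 by rewrite exec.
split=> [X j keeps|X j keeps|keeps].
- apply: (iter_step_invariant (p := predC (writes_nat X)) (f := fun s => nmem s X j));
    last by rewrite /= andbT.
  by case=> //= [Y e v|Y e|Y e] s0; rewrite eq_sym /update /write_bits => /negbTE ->.
- apply: (iter_step_invariant (p := predC (writes_real X)) (f := fun s => rmem s X j));
    last by rewrite /= andbT.
  by case=> //= Y e v s0; rewrite eq_sym /update => /negbTE ->.
- apply: (iter_step_invariant (p := predC draws) (f := @drawn R));
    last by rewrite /= andbT.
  by case.
Qed.

Lemma effect_frame c s : straight c -> frame c s (effect c s).
Proof.
move=> straight_c; have := runs_straight (Post := eq (effect c s)) straight_c erefl.
by move=> /runs_frame[s' [k [_ _ [<-]]]].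
Qed.

End Execution.

(** * The program *)

(* [tester_input] and [accepts] fix arrays 0, 1 and 2. A scalar is kept in cell 0
   of an array [v_...]; [action_keeps] below relies on the arrays from
   [a_counted] on being the last ones. *)

Local Notation a_nodes := 0%N.
Local Notation a_adj := 1%N.
Local Notation a_out := 2%N.
Local Notation v_node := 3%N.
Local Notation v_other := 4%N.
Local Notation v_addr := 5%N.
Local Notation v_size := 6%N.
Local Notation v_idx := 7%N.
Local Notation v_off := 8%N.
Local Notation v_tau := 9%N.
Local Notation v_pow := 10%N.
Local Notation v_m := 11%N.
Local Notation v_sample := 12%N.
Local Notation v_config := 13%N.
Local Notation a_bits := 14%N.
Local Notation a_counted := 15%N.
Local Notation a_read := 16%N.
Local Notation a_ones := 17%N.

Definition get (v : nat) : nexp := NLoad v (NConst 0).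
Definition set (v : nat) (e : nexp) : cmd := NStore v (NConst 0) e.
Definition incr (v : nat) : cmd := set v (NAdd (get v) (NConst 1)).
Definition less (e1 e2 : nexp) : bexp := BLeN (NAdd e1 (NConst 1)) e2.

Definition parent_body : cmd :=
  Seq (If (BLeN (NConst 1) (NLoad a_adj (get v_addr)))
        (Seq (set v_size (NAdd (get v_size) (get v_size)))
             (set v_idx (NAdd (NAdd (get v_idx) (get v_idx))
                              (NLoad a_bits (get v_other)))))
        Skip)
 (Seq (set v_addr (NAdd (get v_addr) (get a_nodes)))
      (incr v_other)).

(* Leaves in [v_size] the number of configurations of the node [v_node], and in
   [v_idx] the rank among them of its configuration in the sample [a_bits]. *)
Definition node_scan : cmd :=
  Seq (Seq (set v_other (NConst 0)) (Seq (set v_size (NConst 1))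
      (Seq (set v_idx (NConst 0)) (set v_addr (get v_node)))))
      (While (less (get v_other) (get a_nodes)) parent_body).

Definition node_end (body : cmd) : cmd :=
  Seq (set v_idx (NAdd (get v_off) (get v_idx)))
 (Seq body
 (Seq (set v_off (NAdd (get v_off) (get v_size))) (incr v_node))).

Definition node_body (body : cmd) : cmd := Seq node_scan (node_end body).

(* Runs [body] for each node, with the index of its table entry in [v_idx]. *)
Definition node_loop (body : cmd) : cmd :=
  Seq (Seq (set v_node (NConst 0)) (set v_off (NConst 0)))
      (While (less (get v_node) (get a_nodes)) (node_body body)).

Definition sample_body (body : cmd) : cmd :=
  Seq (Draw a_bits (NConst 0)) (Seq (node_loop body) (incr v_sample)).

Definition sample_loop (number : nexp) (body : cmd) : cmd :=
  Seq (set v_sample (NConst 0))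
      (While (less (get v_sample) number) (sample_body body)).

Definition count_body : cmd :=
  NStore a_counted (get v_idx) (NAdd (NLoad a_counted (get v_idx)) (NConst 1)).

Definition read_body : cmd :=
  If (less (NLoad a_read (get v_idx)) (NLoad a_counted (get v_idx)))
    (Seq (NStore a_read (get v_idx) (NAdd (NLoad a_read (get v_idx)) (NConst 1)))
         (NStore a_ones (get v_idx)
            (NAdd (NLoad a_ones (get v_idx)) (NLoad a_bits (get v_node)))))
    Skip.

(* Ends with 128 D <= 2 ^ v_tau < 256 D, where D is the value of v_off. *)
Definition tau_loop : cmd :=
  Seq (Seq (set v_pow (NConst 1)) (set v_tau (NConst 7)))
      (While (less (get v_pow) (get v_off))
        (Seq (set v_pow (NAdd (get v_pow) (get v_pow))) (incr v_tau))).

Definition r_eps : rexp := RLoad 0 (NConst 0).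
Definition r_stat : rexp := RLoad 2 (NConst 0).
Definition r_scale : rexp := RMul (RNat (NConst 100)) (RNat (NConst 100)).
Definition r_meps : rexp := RMul (RNat (get v_m)) (RMul r_eps r_eps).

(* The least m with 100 ^ 2 sqrt D <= m eps ^ 2, both sides being squared. *)
Definition m_loop : cmd :=
  Seq (set v_m (NConst 0))
      (While (BNot (BLeR (RMul (RMul r_scale r_scale) (RNat (get v_off)))
                         (RMul r_meps r_meps)))
        (incr v_m)).

Definition r_q : rexp := RLoad 1 (get v_config).
Definition r_counted : rexp := RNat (NLoad a_counted (get v_config)).
Definition r_ones : rexp := RNat (NLoad a_ones (get v_config)).
Definition r_one : rexp := RNat (NConst 1).
Definition r_dev : rexp := RSub r_ones (RMul r_counted r_q).

Definition r_term : rexp :=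
  RDiv (RSub (RSub (RMul r_dev r_dev)
                   (RMul r_ones (RSub r_one (RMul (RNat (NConst 2)) r_q))))
             (RMul r_counted (RMul r_q r_q)))
       (RMul r_counted (RMul r_q (RSub r_one r_q))).

Definition stat_body : cmd :=
  Seq (If (BAnd (BLeN (get v_tau) (NLoad a_counted (get v_config)))
                (BLeN (NLoad a_counted (get v_config)) (NLoad a_read (get v_config))))
        Skip (set a_out (NConst 0)))
 (Seq (RStore 2 (NConst 0) (RAdd r_stat r_term)) (incr v_config)).

Definition stat_loop : cmd :=
  Seq (Seq (set v_config (NConst 0))
           (Seq (set a_out (NConst 1)) (RStore 2 (NConst 0) (RNat (NConst 0)))))
      (While (less (get v_config) (get v_off)) stat_body).

(* With an idle body, the node loop leaves the size of the table in [v_off]. *)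
Definition setup : cmd := Seq (node_loop Skip) (Seq tau_loop m_loop).

Definition sampling : cmd :=
  Seq (sample_loop (get v_m) count_body)
      (sample_loop (NAdd (get v_m) (NAdd (get v_m) (get v_m))) read_body).

Definition decision : cmd :=
  Seq stat_loop
      (If (BLeR (RMul (RNat (NConst 64)) r_stat) r_meps) Skip (set a_out (NConst 0))).

Definition tester : cmd :=
  If (BAnd (BLeN (NConst 1) (get a_nodes)) (BLeR r_eps (RNat (NConst 2))))
    (Seq setup (Seq sampling decision)) (set a_out (NConst 1)).

(* The entries of [a_counted], [a_read] and [a_ones] for one configuration: the
   number N of hits in the first batch, the number of hits in the second batch
   truncated at N, and the number of ones read at these hits. *)
Record tally := Tally { counted : nat; bits_read : nat; ones : nat }.

Definition count_tally (b : bool) (c : tally) : tally :=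
  Tally (counted c).+1 (bits_read c) (ones c).

Definition read_tally (b : bool) (c : tally) : tally :=
  if (bits_read c < counted c)%N then
    Tally (counted c) (bits_read c).+1 (ones c + b)
  else c.

Section Layout.
Variables (n : nat) (adj : nat -> nat -> bool).
Implicit Types (F : bool -> tally -> tally) (x : bitseq).

Fixpoint block_size i j : nat :=
  if j is k.+1 then (if adj k i then (block_size i k).*2 else block_size i k) else 1.

Fixpoint block_index i x j : nat :=
  if j is k.+1 then
    (if adj k i then (block_index i x k).*2 + nth false x k else block_index i x k)%N
  else 0.

Fixpoint offset i : nat := if i is k.+1 then (offset k + block_size k n)%N else 0.

Definition table_pos i x : nat := (offset i + block_index i x n)%N.

Fixpoint visit F x g i (c : tally) : tally :=
  if i is k.+1 then
    let c' := visit F x g k c in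
    if g == table_pos k x then F (nth false x k) c' else c'
  else c.

Definition visit_all F g c (xs : seq bitseq) : tally :=
  foldl (fun c x => visit F x g n c) c xs.

End Layout.

Section Costs.
Variables (n m : nat).

Definition node_cost body := (n * 10 + cost body + 19)%N.
Definition node_loop_cost body := (n * (node_cost body + 1) + 5)%N.
Definition sample_loop_cost M body := (M * (node_loop_cost body + 6) + 5)%N.
Definition setup_cost t := (node_loop_cost Skip + t * 5 + m * 5 + 20)%N.
Definition sampling_cost :=
  (sample_loop_cost m count_body + sample_loop_cost (3 * m) read_body + 1)%N.
Definition decision_cost D := (D * 10 + 20)%N.
Definition main_cost D t := (setup_cost t + sampling_cost + decision_cost D + 2)%N.

End Costs.

Section ProgramCorrectness.
Variables (R : realType) (smp : nat -> bitseq) (coin : nat -> bool).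
Variables (n : nat) (adj : nat -> nat -> bool).
Local Notation runs := (@runs R smp coin).
Local Notation effect := (@effect R smp coin).
Implicit Types (s u : state R) (F : bool -> tally -> tally) (body : cmd).

Definition tally_at s g : tally :=
  Tally (nmem s a_counted g) (nmem s a_read g) (nmem s a_ones g).

Definition graph_in s : Prop :=
  nmem s a_nodes 0 = n /\
  forall i j, (i < n)%N -> (j < n)%N -> nmem s a_adj (i + j * n) = adj j i.

Definition sample_in s (x : bitseq) : Prop :=
  forall j, (j < n)%N -> nmem s a_bits j = nth false x j.

Lemma frame_graph c s s' : keeps_nat a_nodes c -> keeps_nat a_adj c ->
  frame c s s' -> graph_in s -> graph_in s'.
Proof.
by move=> kn ka [fr _ _] [gn ga]; split=> [|i j il jl]; rewrite fr // ga.
Qed.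

Lemma frame_sample c s s' x : keeps_nat a_bits c ->
  frame c s s' -> sample_in s x -> sample_in s' x.
Proof. by move=> kx [fr _ _] sx j jn; rewrite fr // sx. Qed.

Lemma frame_tally c s s' g :
  keeps_nat a_counted c -> keeps_nat a_read c -> keeps_nat a_ones c ->
  frame c s s' -> tally_at s' g = tally_at s g.
Proof. by move=> kc kr ko [fr _ _]; rewrite /tally_at !fr. Qed.

Lemma node_scan_runs s x i : graph_in s -> sample_in s x -> (i < n)%N ->
  nmem s v_node 0 = i ->
  runs node_scan s (n * 10 + 9) (fun s' =>
    nmem s' v_size 0 = block_size adj i n /\ nmem s' v_idx 0 = block_index adj i x n).
Proof.
move=> gr sx ilt si.
pose Inv j t := [/\ graph_in t, sample_in t x, nmem t v_other 0 = j,
  nmem t v_addr 0 = (i + j * n)%N &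
  nmem t v_size 0 = block_size adj i j /\ nmem t v_idx 0 = block_index adj i x j].
apply: (@runs_weaken R smp coin _ _ (7 + (n * (cost parent_body).+1).+1).+1 _ (Inv n)).
- by rewrite /=; lia.
- by move=> s' [].
apply: runs_seq; apply: runs_straight => //.
apply: runs_while => [j t jn [[gn ga] tx tj ta [ts ti]]|t [[gn _] _ tj _ _]|].
- split; first by rewrite /= tj gn addn1.
  apply: runs_straight => //=; rewrite ta ga //.
  case e: (adj j i) => /=; rewrite /Inv /graph_in /sample_in /update /=;
    rewrite gn tj ta ?ts ?ti ?addn1 ?addnn ?tx // e; split=> //; lia.
- by rewrite /= tj gn addn1 ltnn.
- by split=> //; rewrite mul0n addn0.
Qed.

Record tally_action F body : Prop := TallyAction {
  action_straight : straight body;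
  action_keeps : forall X, (X < a_counted)%N -> keeps_nat X body;
  action_drawn : keeps_drawn body;
  action_tally : forall s (b : bool) g, nmem s a_bits (nmem s v_node 0) = b ->
    tally_at (effect body s) g =
    if g == nmem s v_idx 0 then F b (tally_at s g) else tally_at s g }.

Lemma skip_action : tally_action (fun _ c => c) Skip.
Proof. by split=> // s b g _; rewrite if_same. Qed.

Lemma count_action : tally_action count_tally count_body.
Proof.
split=> // [X X15|s b g _].
  by rewrite /keeps_nat /= andbT; apply: contraTN X15 => /eqP <-.
by rewrite /tally_at /= /update /= addn1; case: eqP => [->|].
Qed.

Lemma read_action : tally_action read_tally read_body.
Proof.
split=> // [X X15|s b g xb].
  by rewrite /keeps_nat /= andbT; apply/andP; split; apply: contraTN X15 => /eqP <-.
rewrite /tally_at /read_tally /= addn1.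
by case: ifP => lt; rewrite /= /update /=; case: eqP => [->|] //=;
  rewrite lt ?addn1 ?xb.
Qed.

Definition node_vars : seq nat := [:: v_node; v_other; v_addr; v_size; v_idx; v_off].

Lemma keeps_node_body F body X : tally_action F body ->
  (X < a_counted)%N -> X \notin node_vars -> keeps_nat X (node_body body).
Proof.
move=> act X15; rewrite !inE !negb_or !(eq_sym X).
move=> /and5P[Xn Xo Xa Xs /andP[Xi Xf]].
have := action_keeps act X15; rewrite /keeps_nat /= all_cat /= => ->.
by rewrite Xn Xo Xa Xs Xi Xf.
Qed.

Lemma keeps_node_loop F body X : tally_action F body ->
  (X < a_counted)%N -> X \notin node_vars -> keeps_nat X (node_loop body).
Proof.
move=> act X15 Xv; have := keeps_node_body act X15 Xv; rewrite /keeps_nat /= => ->.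
by move: Xv; rewrite !inE !negb_or !(eq_sym X) => /and5P[-> _ _ _ /andP[_ ->]].
Qed.

Lemma node_body_runs F body s x i : tally_action F body ->
  graph_in s -> sample_in s x -> (i < n)%N ->
  nmem s v_node 0 = i -> nmem s v_off 0 = offset n adj i ->
  runs (node_body body) s (node_cost n body) (fun s' =>
    [/\ nmem s' v_node 0 = i.+1, nmem s' v_off 0 = offset n adj i.+1 &
    forall g, tally_at s' g = if g == table_pos n adj i x
      then F (nth false x i) (tally_at s g) else tally_at s g]).
Proof.
move=> act gr sx ilt si soff; have sb := action_straight act.
apply: (runs_leq (K := ((n * 10 + 9) + cost (node_end body)).+1)).
  by rewrite /node_cost /=; lia.
apply: runs_seq; have := runs_frame (node_scan_runs gr sx ilt si).
apply: runs_weaken => // s1 [[size1 idx1] frame1].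
apply: runs_straight; first by rewrite /= sb.
set s2 := effect (set v_idx (NAdd (get v_off) (get v_idx))) s1.
set s3 := effect body s2.
have nat2 X k : X != v_idx -> keeps_nat X node_scan -> nmem s2 X k = nmem s X k.
  by move=> /negbTE Xidx /(frame_nat frame1) <-; rewrite /s2 /= /update Xidx.
have nat3 X k : (X < a_counted)%N -> nmem s3 X k = nmem s2 X k.
  by move=> /(action_keeps act); apply: (frame_nat (effect_frame smp coin s2 sb)).
have idx2 : nmem s2 v_idx 0 = table_pos n adj i x.
  by rewrite /s2 /= /update /= idx1 (frame_nat frame1) // soff.
have node2 : nmem s2 v_node 0 = i by rewrite nat2.
split; rewrite ?[LHS]/= /update /=.
- by rewrite nat3 // node2 addn1.
- by rewrite nat3 // nat3 // nat2 // soff [nmem s2 _ _]size1.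
move=> g; rewrite [LHS](_ : _ = tally_at s3 g) //.
rewrite (action_tally act (b := nth false x i)) ?idx2; last by rewrite node2 nat2 // sx.
by have -> : tally_at s2 g = tally_at s g by rewrite /tally_at !nat2.
Qed.

Lemma node_loop_runs F body s x : tally_action F body -> graph_in s -> sample_in s x ->
  runs (node_loop body) s (node_loop_cost n body) (fun s' =>
    nmem s' v_off 0 = offset n adj n /\
    forall g, tally_at s' g = visit n adj F x g n (tally_at s g)).
Proof.
move=> act gr sx.
pose Inv i t := [/\ graph_in t, sample_in t x, nmem t v_node 0 = i,
  nmem t v_off 0 = offset n adj i &
  forall g, tally_at t g = visit n adj F x g i (tally_at s g)].
apply: (@runs_weaken R smp coin _ _ (3 + (n * (node_cost n body).+1).+1).+1 _ (Inv n)).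
- by rewrite /node_loop_cost; lia.
- by move=> s' [].
apply: runs_seq; apply: runs_straight => //.
apply: runs_while => [i t ilt [gt tx ti toff tc]|t [[gn _] _ ti _ _]|].
- split; first by rewrite /= ti (proj1 gt) addn1.
  have := runs_frame (node_body_runs act gt tx ilt ti toff).
  apply: runs_weaken => // t' [[ti' toff' tc'] fr].
  split=> //.
  + by apply: frame_graph fr gt; exact: (keeps_node_body act).
  + by apply: frame_sample fr tx; exact: (keeps_node_body act).
  + by move=> g; rewrite tc' tc.
- by rewrite /= ti gn addn1 ltnn.
- by split.
Qed.

Lemma keeps_sample_body F body X : tally_action F body ->
  (X < a_bits)%N -> X \notin v_sample :: node_vars -> keeps_nat X (sample_body body).
Proof.
move=> act X14; rewrite in_cons negb_or => /andP[Xs Xv].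
have := keeps_node_loop act (ltnW X14 : (X < a_counted)%N) Xv.
rewrite /keeps_nat (_ : atoms (sample_body body) =
  [:: Draw a_bits (NConst 0)] ++ (atoms (node_loop body) ++ [:: incr v_sample])) //.
by rewrite all_cat all_seq1 all_cat all_seq1 => -> /=; rewrite !(eq_sym _ X) ltn_eqF.
Qed.

Lemma sample_body_runs F body s k : tally_action F body -> graph_in s ->
  drawn s = k -> size (smp k) = n ->
  runs (sample_body body) s (node_loop_cost n body + 4) (fun s' =>
    [/\ nmem s' v_sample 0 = (nmem s v_sample 0).+1, drawn s' = k.+1,
      nmem s' v_off 0 = offset n adj n &
      forall g, tally_at s' g = visit n adj F (smp k) g n (tally_at s g)]).
Proof.
move=> act gr sk szk.
apply: (runs_leq (K := (1 + (node_loop_cost n body + 1).+1).+1)).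
  by lia.
apply: runs_seq; apply: runs_straight => //; apply: runs_seq.
set s1 := effect _ s.
have sx1 : sample_in s1 (smp k).
  by move=> j jn; rewrite /s1 /= /write_bits /= sk add0n szk jn subn0.
have := runs_frame (node_loop_runs act (gr : graph_in s1) sx1).
apply: runs_weaken => // s2 [[off2 tally2] fr]; apply: runs_straight => //.
have sample2 : nmem s2 v_sample 0 = nmem s v_sample 0.
  by rewrite (frame_nat fr) //; exact: (keeps_node_loop act).
split=> //; first by rewrite /= /update /= sample2 addn1.
rewrite /= (frame_drawn fr) /= ?sk //.
by have := action_drawn act; rewrite /keeps_drawn /= all_cat /= => ->.
Qed.

Lemma sample_loop_runs F body number M d s : tally_action F body -> graph_in s ->
  drawn s = d -> nmem s v_off 0 = offset n adj n ->
  (forall u, nmem u v_m 0 = nmem s v_m 0 -> neval u number = M) ->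
  (forall k, (d <= k < d + M)%N -> size (smp k) = n) ->
  runs (sample_loop number body) s (sample_loop_cost n M body) (fun s' =>
    [/\ graph_in s', drawn s' = (d + M)%N, nmem s' v_off 0 = offset n adj n &
    forall g, tally_at s' g =
      visit_all n adj F g (tally_at s g) [seq smp k | k <- iota d M]]).
Proof.
move=> act gr sd soff number_eval sz.
pose Inv k t := [/\ graph_in t, nmem t v_m 0 = nmem s v_m 0, nmem t v_sample 0 = k,
  drawn t = (d + k)%N /\ nmem t v_off 0 = offset n adj n &
  forall g, tally_at t g =
    visit_all n adj F g (tally_at s g) [seq smp k | k <- iota d k]].
apply: (@runs_weaken R smp coin _ _
  (1 + (M * (node_loop_cost n body + 4).+1).+1).+1 _ (Inv M)).
- by rewrite /sample_loop_cost; lia.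
- by move=> t [? ? ? [? ?] ?].
apply: runs_seq; apply: runs_straight => //.
apply: runs_while => [k t kM [gt tm tk [td _] tc]|t [_ tm tk _ _]|].
- split; first by rewrite /= (number_eval t tm) tk addn1.
  have szk : size (smp (d + k)) = n by apply: sz; lia.
  have := runs_frame (sample_body_runs act gt td szk).
  apply: runs_weaken => // t' [[tk' td' toff' tc'] fr].
  split; [|rewrite (frame_nat fr) //|by rewrite tk' tk|by rewrite td' addnS|].
  + by apply: frame_graph fr gt; exact: (keeps_sample_body act).
  + exact: (keeps_sample_body act).
  + by move=> g; rewrite tc' tc -addn1 iotaD map_cat /visit_all foldl_cat.
- by rewrite /= (number_eval t tm) tk addn1 ltnn.
- by split=> //; rewrite addn0.
Qed.

Lemma tau_loop_runs s D t : nmem s v_off 0 = D ->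
  (forall j, (j < t)%N -> 2 ^ j < D)%N -> (D <= 2 ^ t)%N ->
  runs tau_loop s (t * 5 + 6) (fun s' => nmem s' v_tau 0 = (7 + t)%N).
Proof.
move=> soff lt ge.
pose Inv j u := [/\ nmem u v_off 0 = D, nmem u v_pow 0 = (2 ^ j)%N
  & nmem u v_tau 0 = (7 + j)%N].
apply: (@runs_weaken R smp coin _ _ (3 + (t * 4).+1).+1 _ (Inv t)).
- by lia.
- by move=> u [].
apply: runs_seq; apply: runs_straight => //.
apply: runs_while => [j u jt [uo up ut]|u [uo up ut]|]; last by split.
- split; first by rewrite /= up uo addn1 lt.
  apply: runs_straight => //; split; first exact: uo.
    by rewrite /= /update /= up addnn -mul2n -expnS.
  by rewrite [LHS]/= /update /= ut addn1.
- by rewrite /= up uo addn1 -leqNgt.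
Qed.

Lemma m_loop_runs s D eps m : nmem s v_off 0 = D -> rmem s 0 0 = eps ->
  (forall j, (100 ^+ 2) ^+ 2 * D%:R <= (j%:R * eps ^+ 2) ^+ 2 <-> (m <= j)%N) ->
  runs m_loop s (m * 5 + 6) (fun s' => nmem s' v_m 0 = m).
Proof.
move=> soff seps mP.
pose Inv j u := [/\ nmem u v_off 0 = D, rmem u 0 0 = eps & nmem u v_m 0 = j].
apply: (@runs_weaken R smp coin _ _ (1 + (m * 2).+1).+1 _ (Inv m)).
- by lia.
- by move=> u [].
apply: runs_seq; apply: runs_straight => //.
have cond j u : Inv j u -> reflect (m <= j)%N (beval u (BLeR
   (RMul (RMul r_scale r_scale) (RNat (get v_off))) (RMul r_meps r_meps))).
  move=> [uo ue um]; rewrite [beval _ _]/= uo ue um.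
  by apply: (iffP idP); rewrite -!expr2 => /mP.
apply: runs_while => [j u jm uI|u uI|]; last by split.
- split; first by apply/negP => /(cond j u uI); rewrite leqNgt jm.
  case: uI => uo ue um; apply: runs_straight => //; split=> //.
  by rewrite [LHS]/= /update /= um addn1.
- by rewrite [beval _ _]/= negbK; apply/(cond m u uI).
Qed.

Definition tally_ok tau (c : tally) : bool :=
  (tau <= counted c)%N && (counted c <= bits_read c)%N.

Definition tally_stat (q : R) (c : tally) : R :=
  (((ones c)%:R - (counted c)%:R * q) ^+ 2 - (ones c)%:R * (1 - 2 * q)
   - (counted c)%:R * q ^+ 2) / ((counted c)%:R * (q * (1 - q))).

Lemma stat_loop_runs s D tau : nmem s v_off 0 = D -> nmem s v_tau 0 = tau ->
  runs stat_loop s (D * 10 + 10) (fun s' =>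
    nmem s' a_out 0 = all (fun g => tally_ok tau (tally_at s g)) (iota 0 D) /\
    rmem s' 2 0 = \sum_(0 <= g < D) tally_stat (rmem s 1 g) (tally_at s g)).
Proof.
move=> soff stau.
pose oks j := all (fun g => tally_ok tau (tally_at s g)) (iota 0 j).
pose stats j := \sum_(0 <= g < j) tally_stat (rmem s 1 g) (tally_at s g).
pose Inv j u := [/\ nmem u v_off 0 = D, nmem u v_tau 0 = tau, nmem u v_config 0 = j,
  (forall g, rmem u 1 g = rmem s 1 g /\ tally_at u g = tally_at s g) &
  nmem u a_out 0 = oks j /\ rmem u 2 0 = stats j].
apply: (@runs_weaken R smp coin _ _ (5 + (D * (cost stat_body).+1).+1).+1 _ (Inv D)).
- by rewrite /=; lia.
- by move=> u [].
apply: runs_seq; apply: runs_straight => //.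
apply: runs_while => [j u jD [uo ut uj uq [uout ustat]]|u [uo _ uj _ _]|]; last first.
- by split=> //; rewrite /stats big_geq.
- by rewrite /= uj uo addn1 ltnn.
split; first by rewrite /= uj uo addn1.
apply: runs_straight => //; have [qj [Nj Mj Yj]] := uq j.
have oksS : oks j.+1 = oks j && tally_ok tau (tally_at s j).
  by rewrite /oks -addn1 iotaD all_cat /= andbT.
have statsS : stats j.+1 = rmem u 2 0 + reval u r_term.
  rewrite /stats big_nat_recr //= ustat uj qj Nj Yj /tally_stat /= -!expr2.
  by rewrite mulr1n.
rewrite /Inv oksS statsS /tally_ok [effect _ _]/= ut uj Nj Mj.
by case: (_ && _) => /=; rewrite /update /= ?andbT ?andbF ?uj ?addn1.
Qed.

Lemma setup_runs s eps m t :
  graph_in s -> (forall j, nmem s a_bits j = 0%N) -> rmem s 0 0 = eps ->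
  (forall j, (j < t)%N -> 2 ^ j < offset n adj n)%N -> (offset n adj n <= 2 ^ t)%N ->
  (forall j, (100 ^+ 2) ^+ 2 * (offset n adj n)%:R <= (j%:R * eps ^+ 2) ^+ 2
     <-> (m <= j)%N) ->
  runs setup s (setup_cost n m t) (fun s' =>
    [/\ nmem s' v_off 0 = offset n adj n, nmem s' v_tau 0 = (7 + t)%N,
      nmem s' v_m 0 = m & forall g, tally_at s' g = tally_at s g]).
Proof.
move=> gr x0 seps tlt tge mP.
have sx : sample_in s [::] by move=> j _; rewrite x0 nth_nil.
apply: (runs_leq (K :=
  (node_loop_cost n Skip + ((t * 5 + 6) + (m * 5 + 6)).+1).+1)).
  by rewrite /setup_cost; lia.
apply: runs_seq; have := runs_frame (node_loop_runs skip_action gr sx).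
apply: runs_weaken => // s1 [[off1 tally1] fr1].
apply: runs_seq; have := runs_frame (tau_loop_runs off1 tlt tge).
apply: runs_weaken => // s2 [tau2 fr2].
have off2 : nmem s2 v_off 0 = offset n adj n by rewrite (frame_nat fr2).
have eps2 : rmem s2 0 0 = eps by rewrite (frame_real fr2) // (frame_real fr1).
have := runs_frame (m_loop_runs off2 eps2 mP).
apply: runs_weaken => // s3 [m3 fr3].
have visit_skip g k c : visit n adj (fun _ c => c) [::] g k c = c.
  by elim: k => //= k ->; rewrite if_same.
split=> [| |//|g]; rewrite ?(frame_nat fr3) //.
by rewrite (frame_tally g _ _ _ fr3) // (frame_tally g _ _ _ fr2) // tally1 visit_skip.
Qed.

Definition final_tally m g : tally :=
  visit_all n adj read_tally g
    (visit_all n adj count_tally g (Tally 0 0 0) [seq smp k | k <- iota 0 m])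
    [seq smp k | k <- iota m (3 * m)].

Lemma sampling_runs s m : graph_in s -> drawn s = 0%N ->
  nmem s v_off 0 = offset n adj n -> nmem s v_m 0 = m ->
  (forall g, tally_at s g = Tally 0 0 0) ->
  (forall k, (k < m + 3 * m)%N -> size (smp k) = n) ->
  runs sampling s (sampling_cost n m) (fun s' =>
    [/\ drawn s' = (m + 3 * m)%N, nmem s' v_off 0 = offset n adj n &
    forall g, tally_at s' g = final_tally m g]).
Proof.
move=> gr drawn0 soff sm tally0 sz.
apply: (runs_leq (K := (sample_loop_cost n m count_body +
  sample_loop_cost n (3 * m) read_body).+1)).
  by rewrite /sampling_cost addn1.
have number1 u : nmem u v_m 0 = nmem s v_m 0 -> neval u (get v_m) = m by rewrite sm.
have sz1 k : (0 <= k < 0 + m)%N -> size (smp k) = n by move=> km; apply: sz; lia.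
apply: runs_seq.
have := runs_frame (sample_loop_runs count_action gr drawn0 soff number1 sz1).
apply: runs_weaken => // s1 [[gr1 drawn1 off1 tally1] fr1].
have m1 : nmem s1 v_m 0 = m by rewrite (frame_nat fr1).
have number2 u : nmem u v_m 0 = nmem s1 v_m 0 ->
    neval u (NAdd (get v_m) (NAdd (get v_m) (get v_m))) = (3 * m)%N.
  by rewrite m1 /= => ->; lia.
have sz2 k : (m <= k < m + 3 * m)%N -> size (smp k) = n by move=> km; apply: sz; lia.
have := sample_loop_runs read_action gr1 drawn1 off1 number2 sz2.
apply: runs_weaken => // s2 [_ drawn2 off2 tally2].
by split=> // g; rewrite tally2 tally1 tally0.
Qed.

Definition verdict (tallies : nat -> tally) (q : nat -> R) (eps : R) (D m tau : nat) :=
  all (fun g => tally_ok tau (tallies g)) (iota 0 D) &&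
  (64 * (\sum_(0 <= g < D) tally_stat (q g) (tallies g)) <= m%:R * eps ^+ 2).

Lemma eq_verdict (tallies tallies' : nat -> tally) (q q' : nat -> R) eps D m tau :
  tallies =1 tallies' -> q =1 q' ->
  verdict tallies q eps D m tau = verdict tallies' q' eps D m tau.
Proof.
move=> tE qE; rewrite /verdict (eq_all (fun g => congr1 (tally_ok tau) (tE g))).
by congr (_ && (64 * _ <= _)); apply: eq_bigr => g _; rewrite tE qE.
Qed.

Lemma decision_runs s eps D m tau :
  nmem s v_off 0 = D -> nmem s v_tau 0 = tau -> nmem s v_m 0 = m -> rmem s 0 0 = eps ->
  runs decision s (decision_cost D) (fun s' =>
    nmem s' a_out 0 = verdict (tally_at s) (rmem s 1) eps D m tau).
Proof.
move=> soff stau sm seps.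
apply: (runs_leq (K := ((D * 10 + 10) + 3).+1)).
  by rewrite /decision_cost; lia.
apply: runs_seq; have := runs_frame (stat_loop_runs soff stau).
apply: runs_weaken => // s1 [[out1 stat1] fr1].
have m1 : nmem s1 v_m 0 = m by rewrite (frame_nat fr1).
have eps1 : rmem s1 0 0 = eps by rewrite (frame_real fr1).
apply: runs_straight => //; rewrite [effect _ _]/= m1 eps1 /verdict -stat1 expr2.
by case: ifP => _; rewrite ?andbT ?andbF.
Qed.

Lemma tester_main_runs s eps m t :
  graph_in s -> (forall j, nmem s a_bits j = 0%N) ->
  (forall g, tally_at s g = Tally 0 0 0) -> drawn s = 0%N -> rmem s 0 0 = eps ->
  (forall j, (j < t)%N -> 2 ^ j < offset n adj n)%N -> (offset n adj n <= 2 ^ t)%N ->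
  (forall j, (100 ^+ 2) ^+ 2 * (offset n adj n)%:R <= (j%:R * eps ^+ 2) ^+ 2
     <-> (m <= j)%N) ->
  (forall k, (k < m + 3 * m)%N -> size (smp k) = n) ->
  runs (Seq setup (Seq sampling decision)) s (main_cost n m (offset n adj n) t)
    (fun s' => drawn s' = (m + 3 * m)%N /\
      nmem s' a_out 0 =
      verdict (final_tally m) (rmem s 1) eps (offset n adj n) m (7 + t)).
Proof.
move=> gr x0 tally0 drawn0 seps tlt tge mP sz.
apply: (runs_leq (K := (setup_cost n m t +
  (sampling_cost n m + decision_cost (offset n adj n)).+1).+1)).
  by rewrite /main_cost; lia.
apply: runs_seq; have := runs_frame (setup_runs gr x0 seps tlt tge mP).
apply: runs_weaken => // s1 [[off1 tau1 m1 tally1] fr1].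
have gr1 : graph_in s1 by apply: frame_graph fr1 gr.
have drawn1 : drawn s1 = 0%N by rewrite (frame_drawn fr1).
have tally1_0 g : tally_at s1 g = Tally 0 0 0 by rewrite tally1.
apply: runs_seq; have := runs_frame (sampling_runs gr1 drawn1 off1 m1 tally1_0 sz).
apply: runs_weaken => // s2 [[drawn2 off2 tally2] fr2].
have tau2 : nmem s2 v_tau 0 = (7 + t)%N by rewrite (frame_nat fr2).
have m2 : nmem s2 v_m 0 = m by rewrite (frame_nat fr2).
have eps2 : rmem s2 0 0 = eps by rewrite (frame_real fr2) // (frame_real fr1).
have := runs_frame (decision_runs off2 tau2 m2 eps2).
apply: runs_weaken => // s3 [out3 fr3].
split; first by rewrite (frame_drawn fr3).
rewrite out3 (eq_verdict _ _ _ _ tally2 (q' := rmem s 1)) // => g.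
by rewrite (frame_real fr2) // (frame_real fr1).
Qed.

End ProgramCorrectness.

(** * Factorization of Bayes nets *)

Section ConditionalProbability.
Variables (R : realType) (n : nat) (P : cube n -> R).
Hypothesis P_ge0 : forall x, 0 <= P x.
Implicit Types E F : pred (cube n).

Lemma Pr_ge0 E : 0 <= Pr P E.
Proof. exact: sumr_ge0. Qed.

Lemma eq_Pr E F : E =1 F -> Pr P E = Pr P F.
Proof. exact: eq_bigl. Qed.

Lemma Pr_le E F : {subset E <= F} -> Pr P E <= Pr P F.
Proof.
move=> EF; rewrite /Pr [leRHS](bigID E) /= (eq_bigl E) ?lerDl ?sumr_ge0 // => x.
by case: (boolP (E x)) => [/EF|]; rewrite ?andbF // unfold_in => ->.
Qed.

Lemma Pr_eq0 E F : {subset E <= F} -> Pr P F = 0 -> Pr P E = 0.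
Proof. by move=> /Pr_le EF F0; apply/eqP; rewrite eq_le Pr_ge0 -F0 EF. Qed.

Lemma condPr_mul E F : condPr P E F * Pr P F = Pr P [predI E & F].
Proof.
have [F0|F0] := eqVneq (Pr P F) 0; last by rewrite divfK.
by rewrite F0 mulr0 (Pr_eq0 _ F0) // => x /andP[].
Qed.

Lemma condPr_itv E F : 0 <= condPr P E F <= 1.
Proof.
rewrite /condPr divr_ge0 ?Pr_ge0 //=.
have [->|F0] := eqVneq (Pr P F) 0; first by rewrite invr0 mulr0 ler01.
have Fp : 0 < Pr P F by rewrite lt_neqAle eq_sym F0 Pr_ge0.
by rewrite ler_pdivrMr // mul1r; apply: Pr_le => x /andP[].
Qed.

Lemma Pr_coord E i b :
  Pr P [pred x | E x & x i == b] = bern (condPr P (coord_true i) E) b * Pr P E.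
Proof.
have true_E : Pr P [pred x | E x & x i == true] = condPr P (coord_true i) E * Pr P E.
  by rewrite condPr_mul; apply: eq_Pr => x /=; rewrite eqb_id andbC.
case: b => //=; rewrite mulrBl mul1r -true_E.
rewrite /Pr [in RHS](bigID (fun x : cube n => x i == true)) /= addrC addrK.
by apply: eq_bigl => x; case: (x i).
Qed.

Lemma condPr_partition (I : finType) (h : cube n -> I) E F r : 0 < Pr P F ->
  (forall z, 0 < Pr P [pred x | F x & h x == z] ->
     condPr P E [pred x | F x & h x == z] = r) ->
  condPr P E F = r.
Proof.
move=> F0 cond_r; suff : Pr P [predI E & F] = r * Pr P F.
  by rewrite /condPr => ->; rewrite mulfK // gt_eqF.
rewrite /Pr (partition_big h xpredT) //= [in RHS](partition_big h xpredT) //=.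
rewrite mulr_sumr; apply: eq_bigr => z _.
have cell : Pr P [predI E & [pred x | F x & h x == z]] =
    r * Pr P [pred x | F x & h x == z].
  rewrite -condPr_mul.
  have [->|cell0] := eqVneq (Pr P [pred x | F x & h x == z]) 0; first by rewrite !mulr0.
  by rewrite cond_r // lt_neqAle eq_sym cell0 Pr_ge0.
by rewrite -[RHS]cell; apply: eq_bigl => x /=; rewrite andbA.
Qed.

End ConditionalProbability.

Section BayesFactorization.
Variables (R : realType) (n : nat) (S : rel 'I_n) (P : cube n -> R).
Hypotheses (S_sorted : topsorted S) (P_bayes : bayes_net S P).

Let P_ge0 : forall x, 0 <= P x.
Proof. by case: P_bayes => -[]. Qed.

Lemma parent_values_prefix (i : 'I_n) : depends_on_prefix i (parent_values S i).
Proof.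
by move=> x y xy; apply/eq_in_map => j; rewrite mem_enum inE => /S_sorted /xy.
Qed.

Lemma same_prefixP (i : 'I_n) (x y : cube n) :
  reflect (forall j : 'I_n, (j < i)%N -> y j = x j) (same_prefix i x y).
Proof.
apply: (iffP forallP) => [xy j ji|xy j]; first by have := xy j; rewrite ji => /eqP.
by apply/implyP => ji; rewrite xy.
Qed.

Definition truncate (i : 'I_n) (x : cube n) : cube n :=
  [ffun j : 'I_n => if (j < i)%N then x j else false].

Lemma same_prefixE (i : 'I_n) (x y : cube n) :
  same_prefix i x y = (truncate i y == truncate i x).
Proof.
apply/same_prefixP/eqP => [xy|xy j ji].
  by apply/ffunP => j; rewrite !ffunE; case: ifP => // /xy.
by have := congr1 (fun f : cube n => f j) xy; rewrite !ffunE ji.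
Qed.

Lemma condPr_same_prefix (i : 'I_n) x : 0 < Pr P (same_prefix i x) ->
  condPr P (coord_true i) (same_prefix i x) =
  cond_param S P i (parent_values S i x).
Proof.
case: P_bayes => _ P_local x0; pose F := parent_config S i (parent_values S i x).
have prefix_config y : same_prefix i x y -> F y.
  by move/same_prefixP => xy; rewrite /F /parent_config (parent_values_prefix xy).
have F0 : 0 < Pr P F by apply: lt_le_trans x0 _; apply: Pr_le.
apply/esym/(condPr_partition P_ge0 (h := truncate i)) => // z cell0.
have [y /andP[/= /eqP yF /eqP yz]|none] :=
    pickP [pred y | F y & truncate i y == z]; last first.
  by move: cell0; rewrite /Pr big_pred0 ?ltxx.
have cellE : [pred w | F w & truncate i w == z] =1 same_prefix i y.
  move=> w; rewrite same_prefixE yz /=; case: eqP => [wz|_]; last exact: andbF.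
  rewrite andbT /F /parent_config -yF; apply/eqP/parent_values_prefix/same_prefixP.
  by rewrite same_prefixE yz wz.
move: cell0; rewrite (eq_Pr _ cellE) => y0.
rewrite -(P_local i y x) // /condPr (eq_Pr _ cellE); congr (_ / _).
by apply: eq_Pr => w; exact: (congr1 (andb (coord_true i w)) (cellE w)).
Qed.

(* [same_prefix i] for a length that may also be n. *)
Definition agree_below (k : nat) (x : cube n) : pred (cube n) :=
  fun y => [forall j : 'I_n, (j < k)%N ==> (y j == x j)].

Lemma agree_belowS (i : 'I_n) x y :
  agree_below i.+1 x y = same_prefix i x y && (y i == x i).
Proof.
apply/forallP/andP => [xy|[/forallP xy yxi] j].
  split; last by have := xy i; rewrite ltnSn.
  by apply/forallP => j; apply/implyP => ji; have := xy j; rewrite ltnS ltnW.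
rewrite ltnS leq_eqVlt; apply/implyP => /orP[/eqP/val_inj -> //|ji].
by have := xy j; rewrite ji.
Qed.

Lemma Pr_agree_below k x : (k <= n)%N -> Pr P (agree_below k x) =
  \prod_(i < n | (i < k)%N) bern (cond_param S P i (parent_values S i x)) (x i).
Proof.
elim: k => [_|k IH kn].
  rewrite big_pred0 //; case: P_bayes => -[_ P1] _; rewrite -[RHS]P1.
  by apply: eq_bigl => y; apply/forallP => j.
pose i := Ordinal kn.
rewrite (bigD1 i) //= (eq_bigl (fun j : 'I_n => (j < k)%N)) => [|j]; last first.
  by rewrite ltnS [in RHS]ltn_neqAle andbC -(inj_eq val_inj).
rewrite -(IH (ltnW kn)) (eq_Pr _ (@agree_belowS i x)) (Pr_coord P_ge0).
have [prefix0|prefix0] := eqVneq (Pr P (same_prefix i x)) 0.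
  by rewrite -[Pr P (agree_below k x)]/(Pr P (same_prefix i x)) prefix0 !mulr0.
by rewrite condPr_same_prefix // lt_neqAle eq_sym prefix0 Pr_ge0.
Qed.

Lemma bayes_net_prod x :
  P x = \prod_(i < n) bern (cond_param S P i (parent_values S i x)) (x i).
Proof.
have := Pr_agree_below x (leqnn n).
rewrite (eq_bigl xpredT) => [<-|i]; last exact: ltn_ord.
rewrite /Pr (big_pred1 x) // => y; apply/forallP/eqP => [xy|-> j]; last first.
  by rewrite eqxx implybT.
by apply/ffunP => j; have := xy j; rewrite ltn_ord => /eqP.
Qed.

End BayesFactorization.

(** * Layout of the table of parameters *)

Definition bits_value (s : bitseq) : nat :=
  foldl (fun a (b : bool) => a.*2 + b)%N 0%N s.

Lemma bits_value_cons b s : bits_value (b :: s) = (b * 2 ^ size s + bits_value s)%N.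
Proof.
suff foldl_value a :
    foldl (fun a (b : bool) => a.*2 + b)%N a s = (a * 2 ^ size s + bits_value s)%N.
  by rewrite /bits_value /= foldl_value.
rewrite /bits_value; elim: s a => [|c s IH] a /=; first by rewrite muln1 addn0.
by rewrite IH [in RHS]IH expnS -muln2; lia.
Qed.

Lemma size_all_bits k : size (all_bits k) = (2 ^ k)%N.
Proof. by elim: k => //= k IH; rewrite size_cat !size_map IH addnn -mul2n expnS. Qed.

Lemma bits_value_lt s : (bits_value s < 2 ^ size s)%N.
Proof.
elim: s => // b s IH; rewrite bits_value_cons /= expnS.
by case: b; rewrite ?mul1n ?mul0n; lia.
Qed.

Lemma nth_all_bits s : nth [::] (all_bits (size s)) (bits_value s) = s.
Proof.
elim: s => // b s IH; rewrite /= bits_value_cons nth_cat size_map size_all_bits.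
have lt := bits_value_lt s; case: b; rewrite ?mul1n ?mul0n.
  by rewrite ltnNge leq_addr /= addKn (nth_map [::]) ?size_all_bits ?IH.
by rewrite lt (nth_map [::]) ?size_all_bits ?IH.
Qed.

Lemma all_bits_nth k r : (r < 2 ^ k)%N ->
  size (nth [::] (all_bits k) r) = k /\ bits_value (nth [::] (all_bits k) r) = r.
Proof.
elim: k r => [|k IH] r /=; first by case: r.
rewrite expnS nth_cat size_map size_all_bits => r2; case: ltnP => rk.
  have [sz e] := IH r rk.
  by rewrite (nth_map [::]) ?size_all_bits // bits_value_cons /= sz e mul0n.
have rk' : (r - 2 ^ k < 2 ^ k)%N by lia.
have [sz e] := IH _ rk'.
by rewrite (nth_map [::]) ?size_all_bits // bits_value_cons /= sz e mul1n subnKC.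
Qed.

Lemma nth_sample_bits n (x : cube n) (j : 'I_n) : nth false (sample_bits x) j = x j.
Proof. by rewrite (nth_map j) ?size_enum_ord // nth_ord_enum. Qed.

Lemma size_sample_bits n (x : cube n) : size (sample_bits x) = n.
Proof. by rewrite size_map size_enum_ord. Qed.

Section TableLayout.
Variables (n : nat) (S : rel 'I_n).

Definition nat_adj (j i : nat) : bool :=
  if (insub j, insub i) is (Some a, Some b) then S a b else false.

Lemma nat_adj_ord (a b : 'I_n) : nat_adj a b = S a b.
Proof. by rewrite /nat_adj !valK. Qed.

Lemma size_parent_values i (x : cube n) : size (parent_values S i x) = #|parents S i|.
Proof. by rewrite size_map -cardE. Qed.

Lemma filter_parents (i : 'I_n) :
  [seq k <- iota 0 n | nat_adj k i] = [seq val k | k <- enum (parents S i)].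
Proof.
rewrite -val_enum_ord filter_map; congr map; rewrite enumT.
by apply: eq_filter => k /=; rewrite nat_adj_ord -[RHS]/(k \in parents S i) inE.
Qed.

Lemma block_sizeE (i : 'I_n) : block_size nat_adj i n = (2 ^ #|parents S i|)%N.
Proof.
have block_size_lt k :
    block_size nat_adj i k = (2 ^ size [seq j <- iota 0 k | nat_adj j i])%N.
  elim: k => // k IH; rewrite -addn1 iotaD filter_cat size_cat addn1 /= IH add0n.
  by case: ifP => _ /=; rewrite ?addn0 ?addn1 ?expnS ?mul2n.
by rewrite block_size_lt filter_parents size_map -cardE.
Qed.

Lemma block_indexE (i : 'I_n) (x : cube n) :
  block_index nat_adj i (sample_bits x) n = bits_value (parent_values S i x).
Proof.
have block_index_lt k : block_index nat_adj i (sample_bits x) k =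
    bits_value [seq nth false (sample_bits x) j | j <- iota 0 k & nat_adj j i].
  elim: k => // k IH; rewrite -addn1 iotaD filter_cat map_cat /bits_value foldl_cat.
  by rewrite addn1 /= add0n IH; case: ifP.
rewrite block_index_lt filter_parents -map_comp; congr bits_value.
by apply: eq_map => j /=; exact: nth_sample_bits.
Qed.

Definition block_sizes : seq nat := [seq (2 ^ #|parents S i|)%N | i <- enum 'I_n].

Lemma size_block_sizes : size block_sizes = n.
Proof. by rewrite size_map size_enum_ord. Qed.

Lemma nth_block_sizes (i : 'I_n) : nth 0%N block_sizes i = (2 ^ #|parents S i|)%N.
Proof. by rewrite (nth_map i) ?size_enum_ord // nth_ord_enum. Qed.

Definition table_size : nat := offset n nat_adj n.

Lemma offsetE k : (k <= n)%N -> offset n nat_adj k = sumn (take k block_sizes).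
Proof.
elim: k => [|k IH] kn; first by rewrite take0.
rewrite [LHS]/= (take_nth 0%N) ?size_block_sizes // sumn_rcons IH 1?ltnW //.
by rewrite -[k in nth _ _ k]/(val (Ordinal kn)) nth_block_sizes -block_sizeE.
Qed.

Lemma table_sizeE : table_size = sumn block_sizes.
Proof. by rewrite /table_size offsetE // take_oversize // size_block_sizes. Qed.

Lemma table_size_ge : (n <= table_size)%N.
Proof.
rewrite table_sizeE sumnE big_map big_enum /= -[leqLHS]card_ord -sum1_card.
by apply: leq_sum => i _; rewrite expn_gt0.
Qed.

Lemma table_size_le : (table_size <= n * 2 ^ max_indegree S)%N.
Proof.
rewrite table_sizeE sumnE big_map big_enum /=.
apply: (@leq_trans (\sum_(i < n) 2 ^ max_indegree S)).
  by apply: leq_sum => i _; rewrite leq_exp2l //; exact: leq_bigmax.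
by rewrite sum_nat_const card_ord.
Qed.

Lemma table_posE (i : 'I_n) (x : cube n) :
  table_pos n nat_adj i (sample_bits x) =
  flatten_index block_sizes i (bits_value (parent_values S i x)).
Proof. by rewrite /table_pos offsetE 1?ltnW // block_indexE. Qed.

Lemma parent_values_lt i (x : cube n) :
  (bits_value (parent_values S i x) < nth 0 block_sizes i)%N.
Proof. by rewrite nth_block_sizes -(size_parent_values i x) bits_value_lt. Qed.

Lemma table_pos_lt (i : 'I_n) (x : cube n) :
  (table_pos n nat_adj i (sample_bits x) < table_size)%N.
Proof. by rewrite table_posE table_sizeE; apply/flatten_indexP/parent_values_lt. Qed.

Definition entry_of (i : 'I_n) (x : cube n) : 'I_table_size :=
  Ordinal (table_pos_lt i x).

Lemma entry_node_lt (g : 'I_table_size) : (reshape_index block_sizes g < n)%N.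
Proof.
have := @reshape_indexP block_sizes g; rewrite size_block_sizes; apply.
by rewrite -table_sizeE.
Qed.

Definition entry_node (g : 'I_table_size) : 'I_n := Ordinal (entry_node_lt g).

Definition entry_values (g : 'I_table_size) : bitseq :=
  nth [::] (all_bits #|parents S (entry_node g)|) (reshape_offset block_sizes g).

Lemma entry_rank_lt (g : 'I_table_size) :
  (reshape_offset block_sizes g < 2 ^ #|parents S (entry_node g)|)%N.
Proof. by rewrite -nth_block_sizes; apply: reshape_offsetP; rewrite -table_sizeE. Qed.

Lemma size_entry_values g : size (entry_values g) = #|parents S (entry_node g)|.
Proof. by have [] := all_bits_nth (entry_rank_lt g). Qed.

Lemma entry_ofK i x : entry_node (entry_of i x) = i.
Proof.
apply: val_inj; rewrite /= table_posE; apply: flatten_indexKl; exact: parent_values_lt.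
Qed.

Lemma entry_values_of i x : entry_values (entry_of i x) = parent_values S i x.
Proof.
rewrite /entry_values entry_ofK /= table_posE flatten_indexKr ?parent_values_lt //.
by rewrite -(size_parent_values i x) nth_all_bits.
Qed.

Lemma entry_ofE g x :
  (entry_of (entry_node g) x == g) = parent_config S (entry_node g) (entry_values g) x.
Proof.
apply/eqP/eqP => [<-|xg]; first by rewrite entry_values_of entry_ofK.
apply: val_inj; have -> : val (entry_of (entry_node g) x) = _ := table_posE _ x.
by rewrite xg; have [_ ->] := all_bits_nth (entry_rank_lt g); exact: reshape_indexK.
Qed.

Definition param (R : realType) (P : cube n -> R) (g : 'I_table_size) : R :=
  cond_param S P (entry_node g) (entry_values g).

Lemma nth_param_table (R : realType) (P : cube n -> R) (g : 'I_table_size) :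
  nth 0 (flatten [seq [seq cond_param S P i a | a <- all_bits #|parents S i|]
                 | i <- enum 'I_n]) g = param P g.
Proof.
rewrite nth_flatten.
have -> : shape [seq [seq cond_param S P i a | a <- all_bits #|parents S i|]
                 | i <- enum 'I_n] = block_sizes.
  by rewrite /shape -map_comp; apply: eq_map => i /=; rewrite size_map size_all_bits.
rewrite (nth_map (entry_node g)) ?size_enum_ord ?entry_node_lt //.
rewrite -[reshape_index _ _]/(val (entry_node g)) nth_ord_enum.
by rewrite (nth_map [::]) // size_all_bits entry_rank_lt.
Qed.

Hypothesis S_sorted : topsorted S.

Lemma entry_of_prefix (i : 'I_n) : depends_on_prefix i (entry_of i).
Proof.
move=> x y xy; apply: val_inj; rewrite /= !table_posE.
by rewrite (parent_values_prefix S_sorted xy).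
Qed.

Definition table_system : config_system n 'I_table_size :=
  ConfigSystem entry_ofK entry_of_prefix.

Lemma bayes_net_factorizes (R : realType) (P : cube n -> R) :
  bayes_net S P -> factorizes table_system P (param P).
Proof.
move=> P_bayes; split=> [g|x]; first by apply: condPr_itv; case: P_bayes => -[].
rewrite (bayes_net_prod S_sorted P_bayes); apply: eq_bigr => i _.
by rewrite /param entry_ofK entry_values_of.
Qed.

Lemma hit_prob_table (R : realType) (P : cube n -> R) g :
  hit_prob table_system P g = Pr P (parent_config S (entry_node g) (entry_values g)).
Proof. by apply: eq_bigl => x; exact: entry_ofE. Qed.

Lemma visit_hit F (g : 'I_table_size) (x : cube n) c :
  visit n nat_adj F (sample_bits x) g n c =
  if hit table_system g x then F (hit_bit table_system g x) c else c.
Proof.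
have visit_lt k : (k <= n)%N -> visit n nat_adj F (sample_bits x) g k c =
    if hit table_system g x && (entry_node g < k)%N
    then F (hit_bit table_system g x) c else c.
  elim: k => [_|k IH kn]; first by rewrite /= ltn0 andbF.
  rewrite /= IH; last exact: ltnW.
  pose i := Ordinal kn.
  have -> : (g == table_pos n nat_adj k (sample_bits x) :> nat) =
      hit table_system g x && (entry_node g == i).
    rewrite -[table_pos _ _ _ _]/(val (entry_of i x)) (inj_eq val_inj).
    apply/eqP/andP => [->|[/eqP e /eqP <-]]; last exact: esym.
    by rewrite /hit /= !entry_ofK !eqxx.
  case: (boolP (hit _ _ _)) => //= _; rewrite -(inj_eq val_inj) /= ltnS.
  by case: ltngtP => // e; congr F; rewrite /hit_bit -nth_sample_bits /= e.
by rewrite visit_lt // ltn_ord andbT.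
Qed.

Lemma visit_all_count (g : 'I_table_size) ws :
  visit_all n nat_adj count_tally g (Tally 0 0 0) [seq sample_bits x | x <- ws] =
  Tally (hits table_system ws g) 0 0.
Proof.
suff visit_from a : visit_all n nat_adj count_tally g (Tally a 0 0)
    [seq sample_bits x | x <- ws] = Tally (a + hits table_system ws g) 0 0.
  by rewrite visit_from.
elim: ws a => [|x ws IH] a /=; first by rewrite addn0.
rewrite /visit_all /= visit_hit -/(visit_all _ _ _ _ _ _).
by rewrite /hits /=; case: ifP => _; rewrite IH // -addSnnS.
Qed.

Lemma visit_all_read (g : 'I_table_size) ws N :
  visit_all n nat_adj read_tally g (Tally N 0 0) [seq sample_bits x | x <- ws] =
  Tally N (minn N (hits table_system ws g))
    (count id (take N (tape table_system g ws))).
Proof.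
suff visit_from M Y : (M <= N)%N ->
    visit_all n nat_adj read_tally g (Tally N M Y) [seq sample_bits x | x <- ws] =
    Tally N (minn N (M + hits table_system ws g))
      (Y + count id (take (N - M) (tape table_system g ws))).
  by rewrite visit_from ?subn0.
elim: ws M Y => [|x ws IH] M Y MN /=; first by rewrite addn0 (minn_idPr MN) addn0.
rewrite /visit_all /= visit_hit -/(visit_all _ _ _ _ _ _).
rewrite /hits /tape /=; case: (hit _ _ _) => /=; last by rewrite IH.
rewrite /read_tally /=; case: ltnP => lt.
  rewrite IH // addnS addSn subnS.
  by case: (N - M)%N (subn_gt0 M N) => [|k] /=; rewrite ?lt ?addnA.
rewrite IH // (_ : N - M = 0)%N ?take0 /=; last by lia.
by congr Tally; lia.
Qed.

Section TwoBatches.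
Variables (smp : nat -> bitseq) (m : nat) (ws : seq (cube n)).
Hypothesis size_ws : size ws = (m + 3 * m)%N.
Hypothesis smpE : forall k, (k < m + 3 * m)%N ->
  smp k = nth [::] [seq sample_bits x | x <- ws] k.

Local Notation counts := (hits table_system (take m ws)).

Lemma map_smp d k : (d + k <= m + 3 * m)%N ->
  [seq smp j | j <- iota d k] = [seq sample_bits x | x <- take k (drop d ws)].
Proof.
move=> dk; rewrite map_take map_drop; apply: (@eq_from_nth _ [::]).
  by rewrite size_map size_iota size_takel // size_drop size_map size_ws; lia.
move=> j; rewrite size_map size_iota => jk.
rewrite (nth_map 0%N) ?size_iota // nth_iota // nth_take // nth_drop smpE //; lia.
Qed.

Lemma final_tallyE (g : 'I_table_size) : final_tally smp n nat_adj m g =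
  Tally (counts g) (minn (counts g) (hits table_system (drop m ws) g))
    (count id (take (counts g) (tape table_system g (drop m ws)))).
Proof.
rewrite /final_tally !map_smp ?leqnn // ?leq_addr // drop0 visit_all_count.
by rewrite [take (3 * m) _]take_oversize ?visit_all_read // size_drop size_ws; lia.
Qed.

Lemma verdict_accept (R : realType) (q : nat -> R) (eps : R) tau :
  verdict (final_tally smp n nat_adj m) q eps table_size m tau =
  accept table_system (fun g => q g) m tau eps ws.
Proof.
rewrite /verdict /accept /decide.
have -> : all (fun g => tally_ok tau (final_tally smp n nat_adj m g))
    (iota 0 table_size) = enough table_system tau counts (drop m ws).
  rewrite -val_enum_ord all_map.
  apply/allP/forallP => [ok g|ok g _] /=.
    by have := ok g; rewrite mem_enum /= final_tallyE /tally_ok /= leq_min leqnn; exact.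
  by rewrite final_tallyE /tally_ok /= leq_min leqnn; exact: ok.
apply: andb_id2l => /forallP en.
congr (64 * _ <= _); rewrite big_mkord; apply: eq_bigr => g _.
rewrite final_tallyE /tally_stat /normalized_pair_sum /= pair_sum_count size_takel //.
by rewrite size_tape; case/andP: (en g).
Qed.

End TwoBatches.

End TableLayout.

(** * Running time, thresholds and conclusion *)

Lemma answer_probE (R : realType) n prog (inp : input R) (P : cube n -> R) m t b
    (acc : pred (seq (cube n))) :
  (forall (w : {ffun 'I_m -> cube n}) coin,
     accepts prog inp (stream [::] (fun j => sample_bits (w j))) coin t =
     acc (codom w)) ->
  answer_prob prog inp P m t b = iidPr P m (fun ws => acc ws == b).
Proof.
move=> accE; rewrite /iidPr -iidE_ffun; apply: eq_bigr => w _.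
under eq_bigr do rewrite accE -mulrA.
rewrite -mulr_sumr sumr_const card_ffun card_bool card_ord; congr (_ * _).
by rewrite -[_ *+ _]mulr_natr mulrAC natrX mulVf ?mul1r // expf_neq0 // pnatr_eq0.
Qed.

Lemma nth_flatten_uniform (T : Type) (x0 : T) (ss : seq (seq T)) k i j :
  (forall l, (l < size ss)%N -> size (nth [::] ss l) = k) ->
  (i < k)%N -> (j < size ss)%N ->
  nth x0 (flatten ss) (i + j * k) = nth x0 (nth [::] ss j) i.
Proof.
elim: ss j => //= s ss IH [|j] sz ik js.
  by rewrite mul0n addn0 nth_cat (sz 0%N) // ik.
rewrite nth_cat (sz 0%N) // mulSn ltnNge addnCA leq_addr /= addKn IH //.
by move=> l ls; exact: (sz l.+1).
Qed.

Section TesterInput.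
Variables (R : realType) (n : nat) (S : rel 'I_n) (Q : cube n -> R) (eps : R).

Lemma input_graph : graph_in n (nat_adj S) (init (tester_input S Q eps)).
Proof.
split=> // i j il jl; rewrite /= /tester_input /=.
set rows := [seq [seq nat_of_bool (S a b) | b <- enum 'I_n] | a <- enum 'I_n].
have size_rows : size rows = n by rewrite size_map size_enum_ord.
rewrite (@nth_flatten_uniform _ _ rows n) ?size_rows // => [|l ln]; last first.
  by rewrite (nth_map (Ordinal ln)) ?size_enum_ord // size_map size_enum_ord.
rewrite (nth_map (Ordinal jl)) ?size_enum_ord //.
rewrite (nth_map (Ordinal il)) ?size_enum_ord //.
rewrite -[j in LHS]/(val (Ordinal jl)) -[i in LHS]/(val (Ordinal il)) !nth_ord_enum.
by rewrite -nat_adj_ord.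
Qed.

Lemma input_sizeE :
  input_size (tester_input S Q eps) = (n * n + table_size S + 2)%N.
Proof.
rewrite /input_size /= !addn0 !size_flatten.
have -> : sumn (shape [seq [seq nat_of_bool (S j i) | i <- enum 'I_n] | j <- enum 'I_n])
    = (n * n)%N.
  rewrite /shape -map_comp sumnE big_map big_enum /=.
  under eq_bigr do rewrite size_map size_enum_ord.
  by rewrite sum_nat_const card_ord.
have -> : sumn (shape [seq [seq cond_param S Q i a | a <- all_bits #|parents S i|]
                      | i <- enum 'I_n]) = table_size S.
  rewrite table_sizeE; congr sumn; rewrite /shape -map_comp; apply: eq_map => i /=.
  by rewrite size_map size_all_bits.
lia.
Qed.

Lemma input_size_ge : (1 + n + table_size S <= input_size (tester_input S Q eps))%N.
Proof.
rewrite input_sizeE; have : (n <= n * n)%N by case: (n) => // k; rewrite leq_pmulr.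
lia.
Qed.

End TesterInput.

Lemma main_cost_le n m D t : (t <= D)%N ->
  ((main_cost n m D t).+1 <= 1000 * (1 + n + D + m) ^ 3)%N.
Proof.
move=> tD; set W := (1 + n + D + m)%N.
have nW : (n <= W)%N by rewrite /W; lia.
have mW : (m <= W)%N by rewrite /W; lia.
have DW : (D <= W)%N by rewrite /W; lia.
have W1 : (1 <= W)%N by rewrite /W; lia.
have W3 : (W <= W ^ 3)%N by rewrite -[leqLHS]expn1 leq_pexp2l.
have W23 : (W * W <= W ^ 3)%N by rewrite -[(W * W)%N]/(W ^ 2)%N leq_pexp2l.
have nn : (n * n <= W ^ 3)%N by apply: leq_trans W23; exact: leq_mul.
have mn : (m * n <= W ^ 3)%N by apply: leq_trans W23; exact: leq_mul.
have mnn : (m * (n * n) <= W ^ 3)%N.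
  by rewrite expnS; apply: leq_mul => //; exact: leq_mul.
rewrite /main_cost /setup_cost /sampling_cost /decision_cost.
rewrite /sample_loop_cost /node_loop_cost /node_cost /=.
by move: (W ^ 3)%N W3 nn mn mnn => Z; clearbody W => *; nia.
Qed.

Section Thresholds.
Variable R : realType.

Lemma exp2_le_expR k : 2 ^+ k <= expR k%:R :> R.
Proof.
rewrite -[k%:R]mulr1 expRM_natl lerXn2r ?nnegrE ?expR_ge0 //.
by have := expR_ge1Dx (1 : R); lra.
Qed.

Lemma exp2_up_log_le D : (0 < D)%N -> (2 ^ up_log 2 D <= 2 * D)%N.
Proof.
move=> D0; have [D1|D1] := leqP D 1.
  by have -> : D = 1%N by lia; rewrite up_log1.
have := up_log_gtn (isT : 1 < 2)%N D1.
have : (0 < up_log 2 D)%N by rewrite up_log_gt0.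
by case: (up_log 2 D) => // k _ /=; rewrite expnS; lia.
Qed.

Lemma tau_large D : (0 < D)%N ->
  D%:R * expR (- (7 + up_log 2 D)%:R) <= 1 / 100 :> R.
Proof.
move=> D0; rewrite expRN ler_pdivrMr ?expR_gt0 //.
have := exp2_le_expR (7 + up_log 2 D).
rewrite exprD (_ : 2 ^+ 7 = 128); last by rewrite -natrX.
have : D%:R <= 2 ^+ up_log 2 D :> R by rewrite -natrX ler_nat up_logP.
have : 0 <= D%:R :> R by [].
lra.
Qed.

Lemma dim_sqr_le_expR (n d : nat) (X : R) : (0 < n)%N ->
  12 + 2 * d%:R + 2 * ln n%:R <= X -> 4096 * (n * 2 ^ d)%:R ^+ 2 <= expR X.
Proof.
move=> n0 XL; apply: (@le_trans _ _ (expR (12 + 2 * (d%:R + ln n%:R)))); last first.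
  by rewrite ler_expR; lra.
rewrite expRD expRM_natl (expRD d%:R) lnK ?posrE ?ltr0n //.
apply: ler_pM; rewrite ?sqr_ge0 ?ler0n //.
  by apply: le_trans (exp2_le_expR 12); rewrite -natrX.
rewrite lerXn2r ?nnegrE ?ler0n ?mulr_ge0 ?expR_ge0 // natrM natrX mulrC.
by apply: ler_wpM2r => //; exact: exp2_le_expR.
Qed.

Lemma hits_likely_threshold (n d D : nat) (X : R) : (0 < n)%N -> (0 < D)%N ->
  (D <= n * 2 ^ d)%N -> 12 + 2 * d%:R + 2 * ln n%:R <= X ->
  (2 ^+ (7 + up_log 2 D) + 1) * expR (- X) <= (10 * D%:R)^-1.
Proof.
move=> n0 D0 DU /(dim_sqr_le_expR n0) XL.
have pow_le : 2 ^+ (7 + up_log 2 D) <= 256 * D%:R :> R.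
  rewrite -!natrX -natrM ler_nat expnD.
  by have := exp2_up_log_le D0; rewrite (_ : 2 ^ 7 = 128)%N //; lia.
have D1 : 1 <= D%:R :> R by rewrite ler1n.
rewrite expRN ler_pdivrMr ?expR_gt0 // ler_pdivlMl ?mulr_gt0 ?ltr0n //.
apply: le_trans XL; apply: (@le_trans _ _ (4096 * D%:R ^+ 2)); last first.
  by apply: ler_wpM2l => //; rewrite lerXn2r ?nnegrE ?ler0n // ler_nat.
have : D%:R * (2 ^+ (7 + up_log 2 D) + 1) <= D%:R * (257 * D%:R) :> R.
  by apply: ler_wpM2l => //; lra.
by have := sqr_ge0 (D%:R : R); lra.
Qed.

End Thresholds.

Lemma sample_count (R : realType) (D : nat) (eps : R) (h := Num.sqrt D%:R : R) :
  0 < eps ->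
  exists m : nat,
    [/\ forall j : nat, (100 ^+ 2) ^+ 2 * D%:R <= (j%:R * eps ^+ 2) ^+ 2 <-> (m <= j)%N,
    100 ^+ 2 * h <= m%:R * eps ^+ 2 & m%:R * eps ^+ 2 <= 100 ^+ 2 * h + eps ^+ 2].
Proof.
move=> eps0; have e0 : 0 < eps ^+ 2 by rewrite exprn_gt0.
pose p (j : nat) := 100 ^+ 2 * h <= j%:R * eps ^+ 2.
have h0 : 0 <= h by rewrite sqrtr_ge0.
have lhs0 : 0 <= 100 ^+ 2 * h by rewrite mulr_ge0 // exprn_ge0.
have ex : exists j, p j.
  exists (Num.bound (100 ^+ 2 * h / eps ^+ 2)); rewrite /p -ler_pdivrMr //.
  by apply/ltW/archi_boundP; rewrite divr_ge0 ?(ltW e0).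
case: (ex_minnP ex) => m pm m_min; exists m.
have pP j : p j <-> (m <= j)%N.
  split=> [/m_min //|mj]; apply: (le_trans pm); apply: ler_wpM2r; first exact: ltW.
  by rewrite ler_nat.
split=> // [j|].
  rewrite -pP /p -[X in _ * X <= _](sqr_sqrtr (ler0n R D)) -/h -exprMn.
  by rewrite ler_sqr // nnegrE mulr_ge0 // ltW.
case: m pm m_min pP => [|m] pm m_min pP; first by rewrite mul0r addr_ge0 // ltW.
rewrite -natr1 mulrDl mul1r lerD2r leNgt; apply/negP => lt.
by have /pP : p m by [exact: ltW]; rewrite ltnn.
Qed.

Lemma sqrt_table_le_scale (R : realType) n (S : rel 'I_n) (eps : R) : 0 < eps ->
  Num.sqrt (table_size S)%:R <= sample_scale S eps * eps ^+ 2.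
Proof.
move=> eps0; rewrite /sample_scale divfK ?gt_eqF ?exprn_gt0 //; set a := 2 `^ _.
have a2 : a ^+ 2 = 2 ^+ max_indegree S.
  by rewrite /a -(powR_mulrn 2) ?powR_ge0 // -powRrM divfK ?pnatr_eq0 // powR_mulrn.
rewrite -[a]ger0_norm ?powR_ge0 // -sqrtr_sqr -sqrtrM ?sqr_ge0 //.
by apply: ler_wsqrtr; rewrite a2 -natrX -natrM ler_nat mulnC; exact: table_size_le.
Qed.

Section Regime.
Variables (R : realType) (n : nat) (S : rel 'I_n) (c C eps : R) (Q : cube n -> R).
Hypotheses (n_gt0 : (0 < n)%N) (S_sorted : topsorted S).
Hypotheses (Q_bayes : bayes_net S Q) (Q_balanced : balanced S c C Q).
Hypothesis c_large : log_factor (2 * 1000) 1 n / Num.sqrt n%:R <= c.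
Hypothesis C_large :
  log_factor (2 * 1000) 1 n * ((max_indegree S)%:R * eps ^+ 2 / Num.sqrt n%:R) <= C.

Local Notation D := (table_size S).
Local Notation cs := (table_system S_sorted).
Local Notation lg := (1 + ln n%:R : R).
Local Notation sn := (Num.sqrt n%:R : R).

Lemma table_size_gt0 : (0 < D)%N.
Proof. exact: leq_trans n_gt0 (table_size_ge S). Qed.

Lemma entry_balanced (g : 'I_D) : c <= param Q g <= 1 - c /\
  C <= Pr Q (parent_config S (entry_node g) (entry_values g)).
Proof.
have sz : size (entry_values g) == #|parents S (entry_node g)|.
  by rewrite size_entry_values.
exact: (Q_balanced (Tuple sz)).
Qed.

Lemma log_ge1 : 1 <= lg.
Proof. by rewrite lerDl ln_ge0 // ler1n. Qed.

Lemma sqrt_nodes_ge1 : 1 <= sn.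
Proof. by rewrite -[leLHS]sqrtr1; apply: ler_wsqrtr; rewrite ler1n. Qed.

Lemma sqrt_nodes_le : sn <= Num.sqrt D%:R.
Proof. by apply: ler_wsqrtr; rewrite ler_nat table_size_ge. Qed.

Lemma c_sqrt_ge : 2 * 1000 * lg <= c * sn.
Proof.
have sn0 : 0 < sn by apply: lt_le_trans sqrt_nodes_ge1.
by have := c_large; rewrite /log_factor expr1 ler_pdivrMr.
Qed.

Lemma c_itv : 0 < c <= 1 / 2.
Proof.
have sn1 := sqrt_nodes_ge1; have lg1 := log_ge1; have c_ge := c_sqrt_ge.
have [/andP[c_le_q q_le_c] _] := entry_balanced (Ordinal table_size_gt0).
have sn0 : 0 < sn by exact: lt_le_trans sn1.
apply/andP; split; last by lra.
by rewrite -(pmulr_lgt0 _ sn0); lra.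
Qed.

Lemma param_itv (g : 'I_D) : 0 < param Q g < 1.
Proof.
have [/andP[c_le_q q_le_c] _] := entry_balanced g; have /andP[c_gt0 c_le] := c_itv.
by apply/andP; split; lra.
Qed.

Lemma param_variance_inv_le (g : 'I_D) :
  (param Q g * (1 - param Q g))^-1 <= Num.sqrt D%:R / 1000.
Proof.
have [/andP[c_le_q q_le_c] _] := entry_balanced g; have /andP[c_gt0 c_le] := c_itv.
set q := param Q g in c_le_q q_le_c *.
have qc : c / 2 <= q * (1 - q) by nra.
have sn1 := sqrt_nodes_ge1; have lg1 := log_ge1; have c_ge := c_sqrt_ge.
have c20 : 0 < c / 2 by lra.
apply: (@le_trans _ _ (c / 2)^-1).
  by rewrite lef_pV2 ?posrE //; apply: lt_le_trans qc.
apply: (@le_trans _ _ (sn / 1000)); last by have := sqrt_nodes_le; lra.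
by rewrite -[leLHS]mul1r ler_pdivrMr //; lra.
Qed.

Lemma hit_prob_isolated g : max_indegree S = 0%N -> hit_prob cs Q g = 1.
Proof.
move=> d0; rewrite hit_prob_table; case: Q_bayes => -[_ <-] _; apply: eq_bigl => x.
have no_parents : #|parents S (entry_node g)| = 0%N.
  by apply/eqP; rewrite -leqn0 -d0; exact: leq_bigmax.
rewrite /parent_config; apply/eqP.
by rewrite (size0nil (etrans (size_entry_values g) no_parents))
  (size0nil (etrans (size_parent_values S _ x) no_parents)).
Qed.

Variable m : nat.
Hypothesis eps_itv : 0 < eps <= 2.
Hypothesis m_large : 100 ^+ 2 * Num.sqrt D%:R <= m%:R * eps ^+ 2.

Lemma expected_hits_isolated : 24 + 4 * ln n%:R <= m%:R :> R.
Proof.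
have lg1 := log_ge1; have sD := sqrt_nodes_le; have mL := m_large.
have /andP[_ c_le] := c_itv; have /andP[eps_gt0 eps_le2] := eps_itv.
have : m%:R * eps ^+ 2 <= m%:R * 4 :> R by apply: ler_wpM2l => //; nra.
have : c * sn <= 1 / 2 * sn by apply: ler_wpM2r; rewrite ?sqrtr_ge0.
by have := c_sqrt_ge; lra.
Qed.

Lemma expected_hits_balanced : (0 < max_indegree S)%N ->
  24 + 4 * (max_indegree S)%:R + 4 * ln n%:R <= m%:R * C.
Proof.
set d := max_indegree S => d0; have dR : 1 <= d%:R :> R by rewrite ler1n.
have sn1 := sqrt_nodes_ge1; have lg1 := log_ge1; have sD := sqrt_nodes_le.
have sn0 : 0 < sn by exact: lt_le_trans sn1.
have d_lg : d%:R <= lg * d%:R by rewrite ler_peMl // ler0n.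
have lg_d : lg <= lg * d%:R by rewrite ler_peMr // (le_trans ler01).
apply: (@le_trans _ _ (2 * 1000 * (lg * d%:R))); first by lra.
have := ler_wpM2l (ler0n R m) C_large; apply: le_trans.
rewrite /log_factor expr1 -/d.
have -> : m%:R * (2 * 1000 * lg * (d%:R * eps ^+ 2 / sn)) =
    2 * 1000 * (lg * d%:R) * (m%:R * eps ^+ 2 / sn) by ring.
rewrite ler_peMr //; first by rewrite !mulr_ge0 // (le_trans ler01).
by rewrite ler_pdivlMr // mul1r; have := m_large; lra.
Qed.

Lemma expected_hits_ge g :
  24 + 4 * (max_indegree S)%:R + 4 * ln n%:R <= m%:R * hit_prob cs Q g.
Proof.
have [d0|d0] := posnP (max_indegree S).
  by rewrite d0 hit_prob_isolated // mulr0 addr0 mulr1; exact: expected_hits_isolated.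
apply: (le_trans (expected_hits_balanced d0)).
by rewrite hit_prob_table; apply: ler_wpM2l => //; have [] := entry_balanced g.
Qed.

Lemma hits_likely g :
  (2 ^+ (7 + up_log 2 D) + 1) * expR (- (m%:R * (hit_prob cs Q g / 2))) <=
  (10 * D%:R)^-1.
Proof.
apply: (hits_likely_threshold (d := max_indegree S) n_gt0).
- exact: table_size_gt0.
- exact: table_size_le.
by have := expected_hits_ge g; lra.
Qed.

End Regime.

Section TestCorrectness.
Variables (R : realType) (n : nat) (S : rel 'I_n) (eps : R) (Q : cube n -> R).
Hypotheses (S_sorted : topsorted S) (Q_bayes : bayes_net S Q) (eps_gt0 : 0 < eps).

Local Notation D := (table_size S).
Local Notation cs := (table_system S_sorted).
Local Notation inp := (tester_input S Q eps).

Definition tests (m t : nat) : Prop :=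
  halts_within n tester inp m t /\
  forall P : cube n -> R, bayes_net S P ->
    (P = Q -> 2 / 3 <= answer_prob tester inp P m t true) /\
    (eps < l1_dist P Q -> 2 / 3 <= answer_prob tester inp P m t false).

Section Trivial.
Hypothesis trivial : ~~ ((0 < n)%N && (eps <= 2)).

Lemma l1_dist_le_trivial P : bayes_net S P -> l1_dist P Q <= eps.
Proof.
move=> P_bayes; move: trivial; rewrite negb_and -leqNgt leqn0 -ltNge.
case/orP=> [/eqP n0|eps2]; last first.
  by apply: le_trans (ltW eps2); apply: l1_dist_le2; [case: P_bayes|case: Q_bayes].
have no_nodes (i : 'I_n) : False by have := ltn_ord i; rewrite {2}n0.
rewrite /l1_dist big1 ?(ltW eps_gt0) // => x _.
rewrite (bayes_net_prod S_sorted P_bayes) (bayes_net_prod S_sorted Q_bayes).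
by rewrite !big1 ?subrr ?normr0 // => i; case: (no_nodes i).
Qed.

Lemma tester_trivial_runs smp coin :
  runs smp coin tester (init inp) 2 (fun s => drawn s = 0%N /\ nmem s a_out 0 = 1%N).
Proof.
apply: (@runs_if _ _ _ _ _ _ _ 1); rewrite [beval _ _]/= (negbTE trivial).
exact: runs_straight.
Qed.

Lemma tester_trivial : tests 0 2.
Proof.
split=> [smp coin|P P_bayes].
  have runs_trivial := tester_trivial_runs (fun j => sample_bits (smp j)) coin.
  by rewrite /halts_within; have [s' -> [->]] := runs_run runs_trivial (leqnn 2).
split=> [_|]; last by rewrite ltNge l1_dist_le_trivial.
rewrite (answer_probE (acc := xpredT) P true) /iidPr /= => [|w coin]; first by lra.
set smp := stream _ _; rewrite /accepts.
by have [s' -> [_ /= ->]] := runs_run (tester_trivial_runs smp coin) (leqnn 2).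
Qed.

End Trivial.

Section Regular.
Hypotheses (n_gt0 : (0 < n)%N) (eps_le2 : eps <= 2).
Variable m : nat.
Hypothesis m_minimal : forall j : nat,
  (100 ^+ 2) ^+ 2 * D%:R <= (j%:R * eps ^+ 2) ^+ 2 <-> (m <= j)%N.

Local Notation tau := (7 + up_log 2 D)%N.
Local Notation time := (main_cost n m D (up_log 2 D)).+1.
Local Notation accept := (accept cs (param Q) m tau eps).

Lemma tester_runs smp coin : (forall k, (k < m + 3 * m)%N -> size (smp k) = n) ->
  runs smp coin tester (init inp) time (fun s => drawn s = (m + 3 * m)%N /\
    nmem s a_out 0 =
    verdict (final_tally smp n (nat_adj S) m) (rmem (init inp) 1) eps D m tau).
Proof.
move=> sz; apply: runs_if; rewrite [beval _ _]/= n_gt0 eps_le2.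
apply: tester_main_runs => //.
- exact: input_graph.
- by move=> j; rewrite /= nth_nil.
- by move=> g; rewrite /tally_at /= !nth_nil.
- move=> j; rewrite ltnNge => jt; rewrite ltnNge.
  by apply: contra jt; exact: up_log_min.
- exact: up_logP.
Qed.

Lemma tester_halts : halts_within n tester inp (m + 3 * m) time.
Proof.
move=> smp coin; have sz k : (k < m + 3 * m)%N -> size (sample_bits (smp k)) = n.
  by rewrite size_sample_bits.
by have [s' -> [-> _]] := runs_run (tester_runs coin sz) (leqnn _).
Qed.

Lemma tester_accepts (w : {ffun 'I_(m + 3 * m) -> cube n}) coin :
  accepts tester inp (stream [::] (fun j => sample_bits (w j))) coin time =
  accept (codom w).
Proof.
set smp := stream _ _.
have size_w : size (codom w) = (m + 3 * m)%N by rewrite size_codom card_ord.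
have smpE k : (k < m + 3 * m)%N ->
    smp k = nth [::] [seq sample_bits x | x <- codom w] k.
  move=> km; pose i := Ordinal km; rewrite /smp /stream -[k]/(val i) valK.
  rewrite (nth_map (w i)) ?size_w // (nth_map i) ?size_enum_ord //.
  by rewrite nth_ord_enum.
have sz k : (k < m + 3 * m)%N -> size (smp k) = n.
  by move=> km; rewrite smpE // (nth_map [ffun=> false]) ?size_sample_bits ?size_w.
rewrite /accepts; have [s' -> [_ /= ->]] := runs_run (tester_runs coin sz) (leqnn _).
rewrite eqb0 negbK (verdict_accept S_sorted size_w smpE).
rewrite /accept /decide; congr (_ && (64 * _ <= _)).
by apply: eq_bigr => g _; rewrite /= nth_param_table.
Qed.

Hypothesis m_large : 100 ^+ 2 * Num.sqrt D%:R <= m%:R * eps ^+ 2.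
Hypothesis q_itv : forall g : 'I_D, 0 < param Q g < 1.
Hypothesis q_balanced : forall g : 'I_D,
  (param Q g * (1 - param Q g))^-1 <= Num.sqrt D%:R / 1000.
Hypothesis hits_likely : forall g : 'I_D,
  (2 ^+ tau + 1) * expR (- (m%:R * (hit_prob cs Q g / 2))) <= (10 * D%:R)^-1.

Lemma tester_regular : tests (m + 3 * m) time.
Proof.
have D_gt0 := table_size_gt0 S n_gt0.
have G_gt0 : (0 < #|'I_D|)%N by rewrite card_ord.
have Q_factorizes := bayes_net_factorizes S_sorted Q_bayes.
split=> [|P P_bayes]; first exact: tester_halts.
have P_factorizes := bayes_net_factorizes S_sorted P_bayes.
have P_sum1 := factorizes_sum1 P_factorizes.
split=> [PQ|far]; rewrite (answer_probE P _ tester_accepts).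
- suff : iidPr P (m + 3 * m) (predC accept) <= 1 / 3.
    rewrite iidPrC // /iidPr; under [X in _ -> _ <= X]eq_iidE do rewrite eqb_id; lra.
  rewrite PQ; apply: reject_prob_le; rewrite ?card_ord //.
- suff : iidPr P (m + 3 * m) accept <= 1 / 3.
    have := iidPrC P_sum1 (m + 3 * m) accept; rewrite /iidPr /= => accC.
    under [X in _ -> _ <= X]eq_iidE do rewrite eqbF_neg; rewrite accC; lra.
  apply: (accept_prob_le _ _ _ _ _ P_factorizes Q_factorizes _ far);
    rewrite ?card_ord //.
  exact: tau_large.
Qed.

End Regular.
End TestCorrectness.

Section Budget.
Variables (R : realType) (n : nat) (S : rel 'I_n) (Q : cube n -> R) (eps : R).
Hypothesis eps_gt0 : 0 < eps.

Local Notation D := (table_size S).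
Local Notation scale := (sample_scale S eps).
Local Notation size_inp := (input_size (tester_input S Q eps)).

Definition sample_const : R := 100 ^+ 2 + 4.

Definition within_budget (m t : nat) : Prop :=
  m%:R <= 4 * sample_const * scale /\
  t%:R <= 1000 * sample_const ^+ 3 * (1 + size_inp%:R + scale) ^+ 3.

Lemma sample_const_ge1 : 1 <= sample_const.
Proof. by rewrite /sample_const; lra. Qed.

Lemma sample_scale_ge0 : 0 <= scale.
Proof.
by rewrite !mulr_ge0 ?powR_ge0 ?sqrtr_ge0 // invr_ge0 exprn_ge0 // ltW.
Qed.

Lemma budget_trivial : within_budget 0 2.
Proof.
have K1 := sample_const_ge1; have scale0 := sample_scale_ge0.
have K0 : 0 <= sample_const by exact: le_trans K1.
split; first by rewrite mulr_ge0 // mulr_ge0.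
have K3 : 1 <= sample_const ^+ 3 by rewrite exprn_ege1.
have base1 : 1 <= 1 + size_inp%:R + scale by rewrite -addrA lerDl addr_ge0.
have base3 : 1 <= (1 + size_inp%:R + scale) ^+ 3 by rewrite exprn_ege1.
have := ler_wpM2l (le_trans ler01 K3) base3; lra.
Qed.

Lemma budget_regular m t : (0 < n)%N -> eps <= 2 -> (t <= D)%N ->
  m%:R * eps ^+ 2 <= 100 ^+ 2 * Num.sqrt D%:R + eps ^+ 2 ->
  within_budget (m + 3 * m) (main_cost n m D t).+1.
Proof.
move=> n0 eps2 tD mU; have K1 := sample_const_ge1; have scale0 := sample_scale_ge0.
have eps0 := eps_gt0; have epsX0 : 0 < eps ^+ 2 by rewrite exprn_gt0.
have epsX4 : eps ^+ 2 <= 4 by nra.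
have root1 : 1 <= Num.sqrt D%:R :> R.
  rewrite -[leLHS]sqrtr1; apply: ler_wsqrtr; rewrite ler1n.
  exact: leq_trans n0 (table_size_ge S).
have mK : m%:R <= sample_const * scale.
  rewrite -(ler_pM2r epsX0); apply: (le_trans mU); rewrite -mulrA /sample_const.
  by have := sqrt_table_le_scale S eps_gt0; lra.
split; first by rewrite natrD natrM; lra.
apply: (@le_trans _ _ (1000 * (1 + n + D + m) ^ 3)%:R).
  by rewrite ler_nat; exact: main_cost_le.
rewrite natrM natrX -mulrA -exprMn; apply: ler_wpM2l => //.
apply: lerXn2r; rewrite ?nnegrE ?ler0n //.
  by apply: mulr_ge0; [exact: le_trans K1|rewrite !addr_ge0].
have : (1 + n + D)%:R <= size_inp%:R :> R by rewrite ler_nat input_size_ge.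
have : 1 + size_inp%:R <= sample_const * (1 + size_inp%:R).
  by rewrite ler_peMl ?addr_ge0.
rewrite natrD mulrDr; lra.
Qed.

End Budget.

Theorem theorem5p2 (R : realType) :
  exists (tester : cmd) (A K B : R) (k e : nat),
    [/\ 0 < A, 0 < K & 0 < B] /\
    forall (n : nat) (S : rel 'I_n) (c C eps : R) (Q : cube n -> R),
      topsorted S ->
      bayes_net S Q ->
      balanced S c C Q ->
      log_factor A k n / Num.sqrt n%:R <= c ->
      log_factor A k n * ((max_indegree S)%:R * eps ^+ 2 / Num.sqrt n%:R) <= C ->
      0 < eps ->
      exists m t : nat,
        [/\ m%:R <= K * sample_scale S eps,
            t%:R <= B * (1 + (input_size (tester_input S Q eps))%:R
                           + sample_scale S eps) ^+ e,
            halts_within n tester (tester_input S Q eps) m t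
          & forall P : cube n -> R, bayes_net S P ->
              (P = Q ->
                 2 / 3 <= answer_prob tester (tester_input S Q eps) P m t true) /\
              (eps < l1_dist P Q ->
                 2 / 3 <= answer_prob tester (tester_input S Q eps) P m t false)].
Proof.
have K_gt0 : 0 < sample_const R by exact: lt_le_trans ltr01 (sample_const_ge1 R).
exists tester, (2 * 1000), (4 * sample_const R), (1000 * sample_const R ^+ 3), 1%N, 3%N.
split; first by split; rewrite ?mulr_gt0 ?exprn_gt0 ?ltr0n.
move=> n S c C eps Q S_sorted Q_bayes Q_balanced c_large C_large eps_gt0.
suff [m [t [[m_le t_le] [halts answers]]]] :
    exists m t, within_budget S Q eps m t /\ tests S eps Q m t by exists m, t; split.
have [/andP[n_gt0 eps_le2]|trivial] := boolP ((0 < n)%N && (eps <= 2)); last first.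
  by exists 0%N, 2%N; split; [exact: budget_trivial|exact: tester_trivial].
have [m [m_minimal m_large m_le]] := sample_count (table_size S) eps_gt0.
exists (m + 3 * m)%N, (main_cost n m (table_size S) (up_log 2 (table_size S))).+1.
split.
  by apply: budget_regular => //; apply: up_log_min => //; exact/ltnW/ltn_expl.
apply: (tester_regular (S_sorted := S_sorted)) => // g.
- exact: (param_itv n_gt0 Q_balanced c_large).
- exact: (param_variance_inv_le n_gt0 Q_balanced c_large).
have eps_itv : 0 < eps <= 2 by rewrite eps_gt0.
exact: (hits_likely n_gt0 S_sorted Q_bayes Q_balanced c_large C_large eps_itv m_large).
Qed.
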